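(* There is an absolute constant $C_0>0$ and a constant $K_0>0$ such that for every $K\ge K_0$ there exists $n_0\in\mathbb{N}$ such that the following holds for all $n\ge n_0$. Let $D,m\in\mathbb{N}$ satisfy $D\ge 100$ and $m\le \frac{n}{100D}$. Let $G$ be an $m$-joined graph on $n$ vertices which contains disjoint subsets $V_1,V_2\subseteq V(G)$ with $|V_1|=|V_2|\le \frac{n}{K\log^3 n}$, and set $\ell:=\lfloor C_0\log^3 n\rfloor$. Suppose that the edgeless subgraph $I(V_1\cup V_2)$ with vertex set $V_1\cup V_2$ is $(D,m)$-extendable in $G$. Then there exists a subgraph $S_{res}\subseteq G$ which is $(D,m)$-extendable in $G$ such that for every bijection $\phi\colon V_1\to V_2$ there exists a $P_\ell$-factor of $S_{res}$ consisting, for each $v\in V_1$, of exactly one copy of $P_\ell$ with endpoints $v$ and $\phi(v)$.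
   Context: All graphs are finite and simple, and $\mathbb{N}$ denotes the positive integers. $\log$ is the natural logarithm and $\log^3 n=(\log n)^3$. A graph $G$ is $m$-joined if for any disjoint sets $A,B\subseteq V(G)$ with $|A|,|B|\ge m$ there is at least one edge of $G$ between $A$ and $B$. For $S\subseteq V(G)$, $I(S)$ denotes the subgraph of $G$ with vertex set $S$ and no edges. For $U\subseteq V(G)$, $\Gamma_G(U)=\bigcup_{u\in U}N_G(u)$ is the neighbourhood of $U$ (it may intersect $U$). Let $D,m\in\mathbb{N}$ with $D\ge 3$, let $G$ be a graph and let $S\subseteq G$ be a subgraph with maximum degree $\Delta(S)\le D$. Then $S$ is $(D,m)$-extendable (in $G$) if for all $U\subseteq V(G)$ with $1\le |U|\le 2m$ we have $$|\Gamma_G(U)\setminus V(S)|\ \ge\ (D-1)|U|-\sum_{u\in U\cap V(S)}(d_S(u)-1),$$ where $d_S(u)$ is the degree of $u$ in $S$. $P_\ell$ denotes the path of length $\ell$, i.e. with $\ell$ edges and $\ell+1$ vertices. An $F$-factor in a graph $H$ is a collection of vertex-disjoint copies of $F$ (not necessarily induced subgraphs) in $H$ covering every vertex of $H$. *)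

(* Defs.v *)
From HB Require Import structures.
From mathcomp Require Import all_boot all_order all_algebra.
From mathcomp Require Import reals exp.

Set Implicit Arguments.
Unset Strict Implicit.
Unset Printing Implicit Defensive.

Import Order.TTheory GRing.Theory Num.Theory.

Local Open Scope ring_scope.

(* A simple graph whose vertex set is a subset of the finite type T; a graph
   and its subgraphs thus live in the same type [graph T]. *)
Record graph (T : finType) := Graph {
  verts : {set T};
  adj : rel T;
  adj_sym : symmetric adj;
  adj_irr : irreflexive adj;
  adj_verts : forall x y, adj x y -> x \in verts
}.

Definition subgraph (T : finType) (S G : graph T) : Prop :=
  verts S \subset verts G /\ forall x y, adj S x y -> adj G x y.

Definition nbrs (T : finType) (G : graph T) (u : T) : {set T} :=
  [set v | adj G u v].

Definition Gamma (T : finType) (G : graph T) (U : {set T}) : {set T} :=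
  \bigcup_(u in U) nbrs G u.

Definition degree (T : finType) (G : graph T) (u : T) : nat := #|nbrs G u|.

Definition max_degree (T : finType) (G : graph T) : nat :=
  \max_(u in verts G) degree G u.

Definition joined (T : finType) (m : nat) (G : graph T) : Prop :=
  forall A B : {set T},
    A \subset verts G -> B \subset verts G -> [disjoint A & B] ->
    (m <= #|A|)%N -> (m <= #|B|)%N ->
    exists x y, [/\ x \in A, y \in B & adj G x y].

Definition edgeless (T : finType) (A : {set T}) : graph T :=
  @Graph T A (fun _ _ => false) (fun _ _ => erefl) (fun _ => erefl)
    (fun x y e => False_ind (x \in A) (notF e)).

(* The inequality is between integers: its right-hand side may be negative. *)
Definition extendable (T : finType) (D m : nat) (G S : graph T) : Prop :=
  [/\ subgraph S G,
      (max_degree S <= D)%N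
    & forall U : {set T}, U \subset verts G -> (1 <= #|U| <= 2 * m)%N ->
        (D%:Z - 1) * #|U|%:Z
          - \sum_(u in U :&: verts S) ((degree S u)%:Z - 1)
        <= #|Gamma G U :\: verts S|%:Z].

Definition path_adj (l : nat) : rel 'I_l.+1 :=
  fun i j => (i.+1 == j :> nat) || (j.+1 == i :> nat).

Fact path_adj_sym (l : nat) : symmetric (@path_adj l).
Proof. by move=> i j; rewrite /path_adj orbC. Qed.

Fact path_adj_irr (l : nat) : irreflexive (@path_adj l).
Proof. by move=> i; rewrite /path_adj orbb gtn_eqF. Qed.

Definition path_graph (l : nat) : graph 'I_l.+1 :=
  @Graph 'I_l.+1 [set: 'I_l.+1] (@path_adj l) (@path_adj_sym l)
    (@path_adj_irr l) (fun i j _ => in_setT i).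

(* A copy of F in H, not necessarily induced, is given by an injective
   homomorphism f from F to H; its vertex set is [f @: verts F]. *)
Definition is_copy (A T : finType) (F : graph A) (H : graph T) (f : A -> T) :
    Prop :=
  [/\ {in verts F &, injective f},
      forall a, a \in verts F -> f a \in verts H
    & forall a b, adj F a b -> adj H (f a) (f b)].

(* An F-factor of H, presented as a family of copies indexed by J. *)
Definition is_factor (A T I : finType) (F : graph A) (H : graph T)
    (J : {set I}) (f : I -> A -> T) : Prop :=
  [/\ forall i, i \in J -> is_copy F H (f i),
      {in J &, forall i j, i != j ->
         [disjoint f i @: verts F & f j @: verts F]}
    & \bigcup_(i in J) (f i @: verts F) = verts H].

Definition bij_between (T : finType) (V1 V2 : {set T}) (phi : T -> T) : Prop :=
  {in V1 &, injective phi} /\ phi @: V1 = V2.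

(* [Num.truncn] is the floor, with values in nat, on nonnegative reals. *)
Definition path_length (R : realType) (C0 : R) (n : nat) : nat :=
  Num.truncn (C0 * ln (n%:R : R) ^+ 3).

(* Main.v *)
Require Import Defs.
From HB Require Import structures.
From mathcomp Require Import all_boot all_order all_algebra.
From mathcomp Require Import reals exp.
From mathcomp Require Import zify ring lra.

(** The reservoir is a Benes network drawn inside [G].

    A Benes network of depth [2 * k] routes any permutation of [2 ^ k] wires by
    setting its switches, each of which passes two wires on straight or crossed.
    So it suffices to draw, between two given ends [a], [b] and two new vertices
    [c], [d], a graph all of whose vertices are covered by a path system
    [a -> c], [b -> d] as well as by one [a -> d], [b -> c], all paths having
    one common length [switch_length].  Since every vertex is covered whatever
    the setting, stacking switches yields path factors.

    In a switch ([switch_gadget]), the two systems differ along an even cycle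
    [p1 q1 p2 q2 .. pk qk]: one uses its edges [p_j q_j], the other the edges
    [q_j p_(j+1)] and [q_k p1].  Everything else is shared: long paths join
    [a] to [p1], [b] to [p2], each [q_j] to [p_(j+2)], and the last two [q_j] to
    [c] and [d].  In the first system [a] follows the odd indices and [b] the
    even ones; in the second [a] leaves at once through [q_k] while [b] visits
    all the rest.  The lengths of the four end paths are chosen to make up for
    this imbalance ([ladder] computes them).

    Paths of a prescribed length [l > 2 * h], where [m <= 2 ^ h], are found in
    an expanding graph as usual.  By a submodularity argument of Friedman and
    Pippenger a vertex of an extendable subgraph can be given a new leaf
    ([extend_leaf]); hence one can grow binary trees of depth [h] from both ends.
    Their last levels have [m] vertices and so are joined by an edge, after
    which the unused branches are pruned, which preserves extendability
    ([expands_prune], [connecting_path]).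

    With [m <= n] all of this takes [h] of order [log n], a switch has
    [h ^ 2] vertices up to a constant, and the network has depth of order
    [log n]; this is where [log ^ 3] comes from.  The network creates its own
    outputs; they are finally joined to [V2] by paths whose length makes up
    the difference to [l] ([reservoir]), and any bijection is served by routing
    the corresponding permutation of the outputs. *)

Set Implicit Arguments.
Unset Strict Implicit.
Unset Printing Implicit Defensive.

Import Order.TTheory GRing.Theory Num.Theory.

(** * Adding paths and leaves to a subgraph *)

Section AddingPaths.
Variable T : finType.
Implicit Types (S G : graph T) (x y : T) (q : seq T).

Lemma adj_vertsr S x y : adj S x y -> y \in verts S.
Proof. by rewrite adj_sym; apply: adj_verts. Qed.

Lemma degree_notin S x : x \notin verts S -> degree S x = 0.
Proof.
move=> xS; apply/eqP; rewrite cards_eq0; apply/eqP/setP => y; rewrite !inE.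
by apply: contraNF xS => /adj_verts.
Qed.

Lemma subgraph_trans S1 S2 S3 :
  subgraph S1 S2 -> subgraph S2 S3 -> subgraph S1 S3.
Proof.
move=> [V12 E12] [V23 E23]; split; first exact: subset_trans V23.
by move=> x y /E12/E23.
Qed.

Lemma subgraph_refl S : subgraph S S. Proof. by []. Qed.

(** The conjunct [a != b] makes this irreflexive for all [x] and [y], so that
    [add_edge] is total. *)
Definition add_rel S x y : rel T := fun a b =>
  adj S a b || ((a != b) && ((a == x) && (b == y) || (a == y) && (b == x))).

Fact add_rel_sym S x y : symmetric (add_rel S x y).
Proof.
by move=> a b; rewrite /add_rel adj_sym eq_sym orbC ![(b == _) && _]andbC orbC
  [X in _ && X]orbC.
Qed.

Fact add_rel_irr S x y : irreflexive (add_rel S x y).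
Proof. by move=> a; rewrite /add_rel adj_irr eqxx. Qed.

Fact add_rel_verts S x y a b :
  add_rel S x y a b -> a \in x |: (y |: verts S).
Proof.
rewrite /add_rel !inE => /orP[/adj_verts->|/andP[_ /orP[]/andP[/eqP->]]].
- by rewrite !orbT.
- by rewrite eqxx.
- by rewrite eqxx orbT.
Qed.

Definition add_edge S x y : graph T :=
  @Graph T (x |: (y |: verts S)) (add_rel S x y)
    (@add_rel_sym S x y) (@add_rel_irr S x y) (@add_rel_verts S x y).

Lemma sub_add_edge S x y : subgraph S (add_edge S x y).
Proof.
split=> [|a b Sab]; last by rewrite /= /add_rel Sab.
by apply/subsetP => z Sz; rewrite !inE Sz !orbT.
Qed.

Lemma adj_add_edge S x y : x != y -> adj (add_edge S x y) x y.
Proof. by move=> nxy; rewrite /= /add_rel nxy !eqxx orbT. Qed.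

Lemma verts_add_edge S x y : x \in verts S -> verts (add_edge S x y) = y |: verts S.
Proof.
move=> Sx; apply/setP => z; rewrite !inE.
by case: (z =P x) => [->|]; rewrite ?Sx ?orbT.
Qed.

Lemma degree_add_edge_le S x y v :
  degree (add_edge S x y) v <= degree S v + (v == x) + (v == y).
Proof.
rewrite /degree; set N := nbrs S v.
have sub : nbrs (add_edge S x y) v \subset
    N :|: ((if v == x then [set y] else set0) :|: (if v == y then [set x] else set0)).
  apply/subsetP => w; rewrite !inE /= /add_rel => /orP[-> //|/andP[_]].
  by move=> /orP[]/andP[-> /eqP->]; rewrite !inE eqxx ?orbT.
apply: leq_trans (subset_leq_card sub) _.
apply: leq_trans (leq_card_setU _ _) _; rewrite -addnA leq_add2l.
apply: leq_trans (leq_card_setU _ _) _.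
by apply: leq_add; case: eqP => //; rewrite ?cards1 ?cards0.
Qed.

Lemma degree_sub S S' v : subgraph S S' -> degree S v <= degree S' v.
Proof.
move=> [_ E]; apply/subset_leq_card/subsetP => w; rewrite !inE; exact: E.
Qed.

Lemma degree_add_leaf S s y :
  s \in verts S -> y \notin verts S ->
  degree S s < degree (add_edge S s y) s.
Proof.
move=> Ss Sy; have nsy : s != y by apply: contraNneq Sy => <-.
apply/proper_card/properP; split.
  by apply/subsetP => w; rewrite !inE /= /add_rel => ->.
exists y; rewrite inE ?adj_add_edge //.
by apply: contra Sy => /adj_vertsr.
Qed.

Lemma degree_new_leaf S s y : s \in verts S -> y \notin verts S ->
  0 < degree (add_edge S s y) y.
Proof.
move=> Ss Sy; have nsy : s != y by apply: contraNneq Sy => <-.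
by apply/card_gt0P; exists s; rewrite inE adj_sym adj_add_edge.
Qed.

Lemma card_add_leaf S s y : s \in verts S -> y \notin verts S ->
  #|verts (add_edge S s y)| = #|verts S|.+1.
Proof. by move=> Ss Sy; rewrite verts_add_edge // cardsU1 Sy. Qed.

Fixpoint addpath S x q : graph T :=
  if q is y :: q' then addpath (add_edge S x y) y q' else S.

Lemma addpath_cat S x q1 q2 :
  addpath S x (q1 ++ q2) = addpath (addpath S x q1) (last x q1) q2.
Proof. by elim: q1 S x => //= y q1 IH S x. Qed.

Lemma verts_addpath S x q :
  x \in verts S -> verts (addpath S x q) = verts S :|: [set z in q].
Proof.
elim: q S x => [|y q IH] S x Sx /=; first by apply/setP=> z; rewrite !inE orbF.
rewrite IH; last by rewrite !inE eqxx orbT.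
rewrite verts_add_edge //; apply/setP => z; rewrite !inE.
by case: (z == y); rewrite ?orbT.
Qed.

Lemma sub_addpath S x q : subgraph S (addpath S x q).
Proof.
elim: q S x => [|y q IH] S x /=; first exact: subgraph_refl.
exact: subgraph_trans (sub_add_edge _ _ _) (IH _ _).
Qed.

Lemma path_addpath S x q : uniq (x :: q) -> path (adj (addpath S x q)) x q.
Proof.
elim: q S x => //= y q IH S x /andP[]; rewrite inE negb_or => /andP[nxy _] /= Uq.
rewrite IH // andbT; apply: (sub_addpath _ _ _).2; exact: adj_add_edge.
Qed.

Lemma add_edge_subgraph S G x y :
  subgraph S G -> adj G x y -> subgraph (add_edge S x y) G.
Proof.
move=> [V E] Gxy; split=> [|a b].
  apply/subsetP => z; rewrite !inE => /or3P[/eqP->|/eqP->|/(subsetP V)//].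
    exact: adj_verts Gxy.
  exact: adj_vertsr Gxy.
rewrite /= /add_rel => /orP[/E //|/andP[_ /orP[]/andP[/eqP-> /eqP->//]]].
by rewrite adj_sym.
Qed.

Lemma addpath_subgraph S G x q :
  subgraph S G -> path (adj G) x q -> subgraph (addpath S x q) G.
Proof.
elim: q S x => //= y q IH S x SG /andP[Gxy Gq].
exact: IH (add_edge_subgraph SG Gxy) Gq.
Qed.

(** Each edge of the path is counted at its first end, which is listed in
    [belast x q], and at its second end, which is listed in [q]. *)
Lemma degree_addpath S x q v :
  degree (addpath S x q) v
    <= degree S v + count_mem v (belast x q) + count_mem v q.
Proof.
elim: q S x => [|y q IH] S x /=; first by rewrite !addn0.
apply: leq_trans (IH _ _) _; have := degree_add_edge_le S x y v.
rewrite ![v == _]eq_sym; move: (nat_of_bool _) (nat_of_bool _) (count _ _) (count _ _) => *; lia.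
Qed.

End AddingPaths.

Section Extendability.
Variables (T : finType) (G : graph T) (D m : nat).
Implicit Types (S : graph T) (U W : {set T}) (p : T -> T).

(** The two sides of the inequality in [extendable], with every term moved to
    the side where it counts positively; degrees outside [S] vanish. *)
Definition demand S U := D.-1 * #|U| + #|U :&: verts S|.
Definition supply S U := #|Gamma G U :\: verts S| + \sum_(u in U) degree S u.

Definition expands S := forall U, U \subset verts G -> 0 < #|U| <= 2 * m ->
  demand S U <= supply S U.

Definition nat_extendable S := [/\ subgraph S G, forall v, degree S v <= D & expands S].

Lemma sum_degree_verts S U :
  \sum_(u in U) degree S u = \sum_(u in U :&: verts S) degree S u.
Proof.
rewrite (big_setID (verts S)) /= [X in _ + X]big1 ?addn0 // => u.
by rewrite inE => /andP[uS _]; rewrite degree_notin.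
Qed.

Lemma expand_ineqE S U : 0 < D ->
  ((D%:Z - 1) * #|U|%:Z - \sum_(u in U :&: verts S) ((degree S u)%:Z - 1)
     <= #|Gamma G U :\: verts S|%:Z)%R =
  (demand S U <= supply S U).
Proof.
move=> D0; rewrite /demand /supply sum_degree_verts.
have -> : (\sum_(u in U :&: verts S) ((degree S u)%:Z - 1) =
   (\sum_(u in U :&: verts S) degree S u)%N%:Z - #|U :&: verts S|%:Z)%R.
  by rewrite sumrB sumr_const natz (big_morph Posz PoszD (erefl _)).
have -> : (D%:Z - 1 = D.-1%:Z)%R by lia.
lia.
Qed.

Lemma extP S : 0 < D -> extendable D m G S <-> nat_extendable S.
Proof.
move=> D0; split=> [[SG dS eS]|[SG dS eS]]; split=> //.
- move=> v; have [Sv|/degree_notin->//] := boolP (v \in verts S).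
  by apply: leq_trans dS; rewrite /max_degree (bigD1 v) //= leq_maxl.
- by move=> U UG cU; rewrite -expand_ineqE //; apply: eS.
- by apply/bigmax_leqP => v _.
- by move=> U UG cU; rewrite expand_ineqE //; apply: eS.
Qed.

(** Space for [k] further vertices.  The last two terms leave so many vertices
    outside the subgraph that no set of size between [m] and [2 * m] is tight
    ([tight_small]). *)
Definition room S k := #|verts S| + k + 2 * (D * m) + 3 * m <= #|verts G|.

Lemma room_le S S' k k' : #|verts S'| + k' <= #|verts S| + k -> room S k -> room S' k'.
Proof. rewrite /room; lia. Qed.

Hypothesis jG : joined m G.
Hypothesis D0 : 1 < D.
Hypothesis m0 : 0 < m.

Lemma Gamma0 : Gamma G set0 = set0. Proof. by rewrite /Gamma big_set0. Qed.

Lemma GammaU U W : Gamma G (U :|: W) = Gamma G U :|: Gamma G W.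
Proof. exact: bigcup_setU. Qed.

Lemma GammaS U W : U \subset W -> Gamma G U \subset Gamma G W.
Proof.
move=> UW; apply/bigcupsP => u Uu; apply: (bigcup_sup u) => //.
exact: subsetP UW _ Uu.
Qed.

Lemma mem_Gamma U u v : u \in U -> adj G u v -> v \in Gamma G U.
Proof. by move=> Uu Guv; apply/bigcupP; exists u; rewrite ?inE. Qed.

(** The vertices outside [U] and its neighbourhood send no edge to [U]. *)
Lemma Gamma_large U : U \subset verts G -> m <= #|U| ->
  #|verts G| < #|Gamma G U| + #|U| + m.
Proof.
move=> UG mU; pose B := verts G :\: (Gamma G U :|: U).
have Bm : #|B| < m.
  rewrite ltnNge; apply/negP => mB.
  have [||u [v [Uu Bv Guv]]] := jG UG _ _ mU mB.
  - exact: subsetDl.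
  - rewrite -setI_eq0; apply/eqP/setP => z; rewrite !inE.
    by case: (z \in U); rewrite ?orbT.
  - by move: Bv; rewrite !inE (mem_Gamma Uu Guv).
have : #|verts G| <= #|Gamma G U :|: U| + #|B|.
  rewrite -(cardsID (Gamma G U :|: U) (verts G)) leq_add2r.
  exact/subset_leq_card/subsetIr.
have [cU _] := leq_card_setU (Gamma G U) U; lia.
Qed.


Lemma sum_indicator U (s : T) : \sum_(u in U) (u == s) = (s \in U).
Proof.
have [Us|Us] := boolP (s \in U).
  by rewrite (bigD1 s) //= eqxx big1 // => u /andP[_ /negPf->].
by rewrite big1 // => u Uu; case: eqP Us => // <-; rewrite Uu.
Qed.

Lemma demand_modular S U W : demand S (U :|: W) + demand S (U :&: W) = demand S U + demand S W.
Proof.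
have e1 := cardsUI U W; have := cardsUI (U :&: verts S) (W :&: verts S).
rewrite -setIUl -setIIl /demand; nia.
Qed.

(** Only the neighbourhood term fails to be modular. *)
Lemma supply_submodular S U W :
  supply S (U :|: W) + supply S (U :&: W) <= supply S U + supply S W.
Proof.
have sumUI : \sum_(u in U :|: W) degree S u + \sum_(u in U :&: W) degree S u =
    \sum_(u in U) degree S u + \sum_(u in W) degree S u.
  rewrite (big_setID U) /= setUK setDUl setDv set0U.
  by rewrite [\sum_(u in W) _](big_setID U) /= [W :&: U]setIC; lia.
have := cardsUI (Gamma G U :\: verts S) (Gamma G W :\: verts S).
rewrite -setDUl -GammaU.
have : #|Gamma G (U :&: W) :\: verts S| <=
    #|(Gamma G U :\: verts S) :&: (Gamma G W :\: verts S)|.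
  apply/subset_leq_card; rewrite subsetI !setSD // GammaS //.
    exact: subsetIr.
  exact: subsetIl.
rewrite /supply; lia.
Qed.

(** A set with at least [m] vertices has all but fewer than [m] vertices of [G]
    in its closed neighbourhood, hence more new neighbours than it demands as
    long as [S] leaves room. *)
Lemma tight_small S U : room S 0 -> U \subset verts G -> #|U| <= 2 * m ->
  supply S U <= demand S U -> #|U| < m.
Proof.
rewrite /room /supply /demand => rS UG Um hl; rewrite ltnNge; apply/negP => mU.
have := Gamma_large UG mU.
have := cardsID (verts S) (Gamma G U).
have := subset_leq_card (subsetIr (Gamma G U) (verts S)).
have := subset_leq_card (subsetIl U (verts S)).
have : D * #|U| <= D * (2 * m) by rewrite leq_mul2l Um orbT.
nia.
Qed.

(** Friedman--Pippenger.  If every new neighbour [y] of [s] failed, each would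
    have a violating set, which is then tight for [S], sees [y] and misses [s].
    Tight sets have fewer than [m] elements by joinedness, so by submodularity
    the union of all of them is again tight; adding [s] to that union brings in
    no new neighbour and breaks the expansion of [S]. *)
Lemma extend_leaf S s : nat_extendable S -> room S 0 -> s \in verts S -> degree S s < D ->
  exists y, [/\ adj G s y, y \notin verts S & nat_extendable (add_edge S s y)].
Proof.
move=> [SG dS eS] rS Ss ds; pose Y := [set y | adj G s y & y \notin verts S].
(* [bad y U]: [U] shows that adding the leaf [y] breaks the expansion. *)
pose bad y U := [&& U \subset verts G, 0 < #|U| <= 2 * m &
  supply (add_edge S s y) U < demand (add_edge S s y) U].
case: (pickP [pred y | (y \in Y) && [forall U, ~~ bad y U]]) => [y|none].
  rewrite /= inE => /andP[/andP[Gsy Sy] /forallP good]; exists y; split=> //.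
  have nsy : s != y by apply: contraNneq Sy => <-.
  split=> [|v|U UG cU].
  - exact: add_edge_subgraph.
  - apply: leq_trans (degree_add_edge_le _ _ _ _) _.
    case: (v =P s) => [->|_]; first by rewrite (negPf nsy) /=; lia.
    case: (v =P y) => [->|_]; last by have := dS v; lia.
    by rewrite (degree_notin Sy); lia.
  - by have := good U; rewrite /bad UG cU /= -leqNgt.
pose P U := [/\ U \subset verts G, #|U| < m, supply S U <= demand S U & s \notin U].
have sG : s \in verts G by apply: subsetP Ss; case: SG.
have lowhigh U : U \subset verts G -> #|U| <= 2 * m -> demand S U <= supply S U.
  move=> UG Um; have [U0|U0] := posnP #|U|; last by apply: eS; rewrite ?U0.
  by rewrite (cards0_eq U0) /demand cards0 set0I cards0 muln0.
pose Uf y := odflt set0 [pick U | bad y U].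
have PU y : y \in Y -> P (Uf y) /\ y \in Gamma G (Uf y).
  rewrite inE => /andP[Gsy Sy]; have nsy : s != y by apply: contraNneq Sy => <-.
  have [U badU eU] : exists2 U, bad y U & Uf y = U.
    rewrite /Uf; case: pickP => [U bU|nU]; first by exists U.
    have := none y; rewrite /= inE Gsy Sy /=; case: forallP => // [[]] U.
    by rewrite nU.
  rewrite eU; case/and3P: badU => UG cU; rewrite ltnNge => nhl.
  have UG' := UG; have lh : demand S U <= supply S U by apply: eS.
  have lowle : demand (add_edge S s y) U <= demand S U + (y \in U).
    rewrite /demand -addnA leq_add2l verts_add_edge // setIUr.
    have [+ _] := leq_card_setU (U :&: [set y]) (U :&: verts S).
    suff : #|U :&: [set y]| <= (y \in U) by lia.
    have [Uy|Uy] := boolP (y \in U); first by rewrite (leq_trans (subset_leq_card (subsetIr _ _))) ?cards1.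
    rewrite leqn0 cards_eq0; apply/eqP/setP => z; rewrite !inE.
    by case: eqP => [->|]; rewrite ?(negPf Uy) ?andbF.
  have degle : \sum_(u in U) degree S u + (s \in U) + (y \in U)
      <= \sum_(u in U) degree (add_edge S s y) u.
    rewrite -!sum_indicator -!big_split /=; apply: leq_sum => u _.
    case: (u =P s) => [->|_]; first by rewrite (negPf nsy) addn0 addn1 degree_add_leaf.
    case: (u =P y) => [->|_].
      by rewrite (degree_notin Sy) degree_new_leaf.
    by rewrite !addn0; apply/degree_sub/sub_add_edge.
  have newle : #|Gamma G U :\: verts S| <=
      #|Gamma G U :\: verts (add_edge S s y)| + (y \in Gamma G U).
    rewrite verts_add_edge //.
    rewrite (cardsD1 y (Gamma G U :\: verts S)) !inE Sy /= addnC leq_add2r.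
    apply/subset_leq_card/subsetP => z; rewrite !inE.
    by case: (z == y) => //=; case: (z \in verts S).
  have nUs : s \notin U.
    apply/negP => Us; apply: (negP nhl); move: lowle degle newle lh; rewrite Us /demand /supply.
    by case: (y \in Gamma G U) => /=; clear; lia.
  have Ty : y \in Gamma G U.
    apply/negPn/negP => /negPf Ty; apply: (negP nhl).
    by move: lowle degle newle lh; rewrite Ty /demand /supply; clear; lia.
  have hl : supply S U <= demand S U.
    rewrite leqNgt; apply/negP => hl; apply: (negP nhl).
    by move: lowle degle newle lh hl; rewrite Ty /demand /supply; clear; lia.
  by split=> //; split=> //; apply: (tight_small rS) => //; case/andP: cU.
(* Uncrossing: two tight sets that miss [s] have a tight union, which is again
   smaller than [m]. *)
pose W := \bigcup_(y in Y) Uf y.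
have PW : P W.
  apply: (big_ind P) => [|U1 U2 [G1 m1 t1 s1] [G2 m2 t2 s2]|y /PU[]//].
    by split; rewrite ?sub0set ?cards0 ?inE // /supply Gamma0 set0D cards0 big_set0.
  have Gu : U1 :|: U2 \subset verts G by rewrite subUset G1.
  have cu : #|U1 :|: U2| <= 2 * m by have [+ _] := leq_card_setU U1 U2; move: m1 m2; clear; lia.
  have tu : supply S (U1 :|: U2) <= demand S (U1 :|: U2).
    have := supply_submodular S U1 U2; have := demand_modular S U1 U2.
    have : demand S (U1 :&: U2) <= supply S (U1 :&: U2).
      apply: lowhigh; first by apply: subset_trans G1; apply: subsetIl.
      by have := subset_leq_card (subsetIl U1 U2); lia.
    lia.
  by split=> //; [apply: (tight_small rS) | rewrite inE negb_or s1].
case: PW => WG Wm tW sW.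
have := lowhigh (s |: W); rewrite subUset sub1set sG WG cardsU1 sW /=.
have -> : 1 + #|W| <= 2 * m by lia.
move=> /(_ isT isT); rewrite /demand /supply cardsU1 sW big_setU1 //=.
have -> : #|(s |: W) :&: verts S| = (#|W :&: verts S|).+1.
  rewrite setIUl (setIidPl _) ?sub1set // cardsU1 inE (negPf sW) //.
have : #|Gamma G (s |: W) :\: verts S| <= #|Gamma G W :\: verts S|.
  rewrite GammaU; apply/subset_leq_card/subsetP => z; rewrite !inE.
  case/andP=> Sz /orP[/bigcupP[u]|-> //]; last by rewrite Sz.
  rewrite inE => /eqP->; rewrite inE => Gsz; rewrite Sz /=.
  have Yz : z \in Y by rewrite inE Gsz.
  have [_ zU] := PU _ Yz; apply: subsetP zU; apply: GammaS.
  exact: (bigcup_sup z).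
move: tW; rewrite /demand /supply; nia.
Qed.

(** Cutting branches off keeps extendability: a vertex [u] that loses children
    loses that much degree, but those children become new neighbours of [u]
    that no other vertex can claim.  [p w] is the parent of a removed [w]. *)
Lemma expands_prune S S' p : expands S' -> verts S \subset verts S' ->
  (forall w, w \in verts S' :\: verts S -> adj G (p w) w) ->
  (forall u v, adj S' u v -> [\/ adj S u v,
      v \in verts S' :\: verts S /\ p v = u | u \in verts S' :\: verts S /\ p u = v]) ->
  expands S.
Proof.
move=> eS' SS' pG pE U UG cU; have := eS' U UG cU; rewrite /demand /supply.
set Y := verts S' :\: verts S in pG pE *.
have pw u : degree S' u <= degree S u + #|[set y in Y | p y == u]| + (u \in Y).
  have : nbrs S' u \subset nbrs S u :|: [set y in Y | p y == u] :|:
      (if u \in Y then [set p u] else set0).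
    apply/subsetP => v; rewrite inE => /pE H; rewrite !in_setU.
    case: H => [Suv|[Yv <-]|[Yu <-]]; first by rewrite [v \in nbrs S u]inE Suv.
      by rewrite [v \in [set y in Y | _]]inE Yv eqxx orbT.
    by rewrite Yu set11 orbT.
  move=> /subset_leq_card; rewrite -/(degree S' u) => /leq_trans-> //.
  apply: leq_trans (leq_card_setU _ _) _; apply: leq_add.
    by apply: leq_trans (leq_card_setU _ _) _.
  by case: ifP; rewrite ?cards1 ?cards0.
have sumle : \sum_(u in U) degree S' u <= \sum_(u in U) degree S u +
    #|[set y in Y | p y \in U]| + #|U :&: Y|.
  apply: (@leq_trans (\sum_(u in U)
    (degree S u + #|[set y in Y | p y == u]| + (u \in Y)))).
    by apply: leq_sum => u _; apply: pw.
  rewrite !big_split /= leq_add //.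
    rewrite leq_add2l -sum1_card.
    under eq_bigr => u _ do rewrite -sum1_card.
    rewrite (exchange_big_dep (mem [set y in Y | p y \in U])) /=; last first.
      by move=> u y Uu; rewrite !inE => /andP[-> /eqP->].
    apply: leq_sum => y; rewrite !inE => /andP[Yy Upy].
    rewrite (bigD1 (p y)) /= ?big1 // ?inE ?Upy ?Yy ?eqxx //.
    by move=> u /andP[/andP[_]]; rewrite !inE => /andP[_ /eqP->]; rewrite eqxx.
  rewrite -sum1_card big_mkcond [X in _ <= X]big_mkcond /=; apply: leq_sum => u _.
  by rewrite [u \in U :&: Y]inE; case: (u \in U); case: (u \in Y).
have cV : #|U :&: verts S'| = #|U :&: verts S| + #|U :&: Y|.
  rewrite -(cardsID (verts S)) setDE -!setIA -setDE (setIidPr SS') //.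
have cG : #|Gamma G U :\: verts S'| + #|[set y in Y | p y \in U]| <=
    #|Gamma G U :\: verts S|.
  rewrite -(cardsID (verts S') (Gamma G U :\: verts S)) addnC leq_add //.
    apply/subset_leq_card/subsetP => y; rewrite inE => /andP[Yy Upy].
    have Gy := mem_Gamma Upy (pG _ Yy).
    by move: Yy; rewrite !inE Gy => /andP[-> ->].
  apply/subset_leq_card/subsetP => y; rewrite !inE => /andP[S'y ->].
  by rewrite S'y andbT; apply: contra S'y => /(subsetP SS').
lia.
Qed.

End Extendability.

(** * Connecting paths of prescribed length *)

Section LinkDegrees.
Variable T : finType.
Implicit Types (S : graph T) (x y v : T) (q r : seq T).

Lemma degree_link_new S x q v : uniq (x :: q) -> v \notin verts S ->
  degree (addpath S x q) v <= 2.
Proof.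
move=> /= /andP[xq Uq] Sv; apply: leq_trans (degree_addpath _ _ _ _) _.
have Ub : uniq (belast x q).
  by have := lastI x q; case/(congr1 uniq); rewrite /= xq Uq rcons_uniq; case/esym/andP.
rewrite (degree_notin Sv) !count_uniq_mem //.
by case: (_ \in _); case: (_ \in _).
Qed.

Lemma degree_link_old S x y r v : x != y -> x \in verts S ->
  {in r, forall z, z \notin verts S} -> v \in verts S ->
  degree (addpath S x (rcons r y)) v <= degree S v + (v == x) + (v == y).
Proof.
move=> nxy Sx rS Sv; apply: leq_trans (degree_addpath _ _ _ _) _.
have vr : count_mem v r = 0 by apply/count_memPn; apply: contraL Sv; apply: rS.
by rewrite belast_rcons -cats1 /= count_cat /= vr addn0 add0n addn0 ![v == _]eq_sym.
Qed.

Lemma degree_pendant_old S x q v : x \in verts S ->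
  {in q, forall z, z \notin verts S} -> v \in verts S ->
  degree (addpath S x q) v <= degree S v + (v == x).
Proof.
move=> Sx qS Sv; apply: leq_trans (degree_addpath _ _ _ _) _.
have vq r : {subset r <= q} -> count_mem v r = 0.
  by move=> rq; apply/count_memPn; apply: contraL Sv => /rq; apply: qS.
rewrite (vq q) // addn0 leq_add2l.
case: q qS vq => //= y q _ vq; rewrite (vq (belast y q)) ?addn0 ?[v == _]eq_sym //.
exact: mem_belast.
Qed.

Lemma degree_pendant_last S x q : uniq (x :: q) -> last x q \notin verts S ->
  degree (addpath S x q) (last x q) <= 1.
Proof.
move=> Uxq Sl; apply: leq_trans (degree_addpath _ _ _ _) _.
rewrite (degree_notin Sl) add0n.
have : uniq (rcons (belast x q) (last x q)) by rewrite -lastI.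
rewrite rcons_uniq => /andP[/count_memPn-> _].
by case/andP: Uxq => _ Uq; rewrite (count_uniq_mem _ Uq); case: (_ \in _).
Qed.

End LinkDegrees.

Section Connecting.
Variables (T : finType) (G : graph T) (D m h : nat).
Implicit Types (S : graph T) (U W : {set T}) (p : T -> T) (q : seq T).
Hypothesis jG : joined m G.
Hypothesis D4 : 4 <= D.
Hypothesis m0 : 0 < m.

Let D1 : 1 < D. Proof. by lia. Qed.
Local Notation ext := (nat_extendable G D m).
Local Notation room := (room G D m).

Lemma pendant l S x : ext S -> room S l -> x \in verts S -> degree S x < D ->
  exists q, [/\ size q = l, uniq q, {in q, forall z, z \notin verts S},
     path (adj G) x q & ext (addpath S x q)].
Proof.
elim: l S x => [|l IH] S x eS rS Sx dx; first by exists [::].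
have rS0 : room S 0 by apply: room_le rS; lia.
have [y [Gxy Sy eS1]] := extend_leaf jG D1 m0 eS rS0 Sx dx.
have nxy : (y == x) = false by apply/negbTE; apply: contraNneq Sy => ->.
have [||||q [sq Uq nq pq eq]] := IH (add_edge S x y) y.
- by [].
- by apply: room_le rS; rewrite card_add_leaf //; lia.
- by rewrite !inE eqxx orbT.
- have := degree_add_edge_le S x y y; rewrite (degree_notin Sy) nxy eqxx; lia.
have ny z : z \in q -> z \notin y |: verts S by rewrite -(@verts_add_edge _ S x) //; apply: nq.
exists (y :: q); split=> //=; first by rewrite sq.
- by rewrite Uq andbT; apply/negP => /ny; rewrite !inE eqxx.
- move=> z; rewrite inE => /predU1P[->//|/ny]; rewrite !inE negb_or.
  by case/andP.
- by rewrite Gxy.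
Qed.

(** Trees attached to [S0], recorded by the parents [p] of the new vertices
    since this is what [expands_prune] works with. *)
Definition forest S0 S p :=
  [/\ subgraph S0 S, forall w, w \in verts S :\: verts S0 -> adj S (p w) w &
   forall u v, adj S u v -> [\/ adj S0 u v,
      v \in verts S :\: verts S0 /\ p v = u | u \in verts S :\: verts S0 /\ p u = v]].

Lemma forest_refl S p : forest S S p.
Proof. by split=> // [w|u v]; [rewrite setDv inE | constructor 1]. Qed.

Lemma forest_leaf S0 S p s : forest S0 S p -> ext S -> room S 0 ->
  s \in verts S -> degree S s < D ->
  exists y p', [/\ y \notin verts S, ext (add_edge S s y),
    forest S0 (add_edge S s y) p', p' y = s & {in verts S, p' =1 p}].
Proof.
move=> [S0S pS pE] eS rS Ss ds.
have [y [Gsy Sy eS1]] := extend_leaf jG D1 m0 eS rS Ss ds.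
have nsy : s != y by apply: contraNneq Sy => <-.
exists y, (fun z => if z == y then s else p z); split=> //.
- have S1 := sub_add_edge S s y.
  have S0y : y \notin verts S0 by apply: contra Sy => /(subsetP S0S.1).
  have newE z : z \in verts (add_edge S s y) :\: verts S0 ->
      z = y \/ z != y /\ z \in verts S :\: verts S0.
    rewrite verts_add_edge // !inE => /andP[-> ] /predU1P[->|->]; first by left.
    by case: eqP => [->|]; [left | right].
  have newE' z : z \in verts S :\: verts S0 ->
      z \in verts (add_edge S s y) :\: verts S0.
    by rewrite !inE => /andP[-> ->]; rewrite !orbT.
  have Sny z : z \in verts S -> (z == y) = false by move=> Sz; apply: contraNF Sy => /eqP<-.
  split; first exact: subgraph_trans S1.
  + move=> w /newE[->|[/negPf-> /pS]]; first by rewrite eqxx; apply: adj_add_edge.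
    exact: S1.2.
  + move=> u v; rewrite /= /add_rel => /orP[Suv|/andP[_ /orP[]/andP[/eqP-> /eqP->]]].
    * rewrite (Sny _ (adj_verts Suv)) (Sny _ (adj_vertsr Suv)).
      by case: (pE _ _ Suv) => [?|[/newE' ? ?]|[/newE' ? ?]];
        [constructor 1|constructor 2|constructor 3].
    * by constructor 2; rewrite eqxx !inE eqxx S0y orbT.
    * by constructor 3; rewrite eqxx !inE eqxx S0y orbT.
- by rewrite eqxx.
- by move=> z Sz; case: eqP Sy Sz => // -> /negPf->.
Qed.

(** Children are added to one vertex of the level after the other.  The last
    clause is what keeps the vertices that wait for their turn, and those
    outside the tree, at their old degree. *)
Lemma forest_level S0 vs S p : forest S0 S p -> ext S -> room S (2 * size vs) ->
  uniq vs -> {in vs, forall v, v \in verts S /\ degree S v + 2 <= D} ->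
  exists S' p' ws, [/\ forest S0 S' p', ext S', subgraph S S',
      #|verts S'| = #|verts S| + 2 * size vs & {in verts S, p' =1 p}] /\
    [/\ size ws = 2 * size vs, uniq ws,
     {in ws, forall w, [/\ w \in verts S', w \notin verts S, p' w \in vs & degree S' w <= 1]} &
     {in verts S, forall v, v \notin vs -> degree S' v <= degree S v}].
Proof.
elim: vs S p => [|v vs IH] S p fS eS rS.
  by move=> _ _; exists S, p, [::]; do ! split=> //; rewrite addn0.
move=> /= /andP[nv Uvs] vsS; have [Sv dv] := vsS v (mem_head _ _).
have mem_tl z : z \in vs -> z \in v :: vs by move=> vz; rewrite inE vz orbT.
have [||y1 [p1 [Sy1 eS1 fS1 p1y p1p]]] := forest_leaf (s := v) fS eS _ Sv.
- by apply: room_le rS; lia.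
- by lia.
set S1 := add_edge S v y1 in eS1 fS1.
have n1 z : z \in verts S -> (z == y1) = false by move=> Sz; apply: contraNF Sy1 => /eqP<-.
have c1 : #|verts S1| = #|verts S|.+1 by rewrite card_add_leaf.
have sS1 : subgraph S S1 := sub_add_edge _ _ _.
have S1v : v \in verts S1 by apply: (subsetP sS1.1).
have S1y1 : y1 \in verts S1 by rewrite !inE eqxx orbT.
have dS1 z : degree S1 z <= degree S z + (z == v) + (z == y1) := degree_add_edge_le S v y1 z.
have [||y2 [p2 [Sy2 eS2 fS2 p2y p2p]]] := forest_leaf (s := v) fS1 eS1 _ S1v.
- by apply: room_le rS; rewrite c1 /=; lia.
- by have := dS1 v; rewrite eqxx n1 // -/S1; lia.
set S2 := add_edge S1 v y2 in eS2 fS2.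
have n2 z : z \in verts S1 -> (z == y2) = false by move=> Sz; apply: contraNF Sy2 => /eqP<-.
have c2 : #|verts S2| = #|verts S1|.+1 by rewrite card_add_leaf.
have sS2 : subgraph S1 S2 := sub_add_edge _ _ _.
have dS2 z : degree S2 z <= degree S1 z + (z == v) + (z == y2) := degree_add_edge_le S1 v y2 z.
have d2 z : z \in verts S -> z != v -> degree S2 z <= degree S z.
  move=> Sz /negPf nz; have := dS2 z; have := dS1 z; rewrite nz n1 // n2; first by clear; lia.
  exact: subsetP sS1.1 _ Sz.
have y1v : (y1 == v) = false by apply: contraNF Sy1 => /eqP->.
have y2v : (y2 == v) = false by apply: contraNF Sy2 => /eqP->.
have y12 : (y1 == y2) = false by apply: n2.
have Sy2' : y2 \notin verts S by apply: contra Sy2; apply: (subsetP sS1.1).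
have S2S : {subset verts S <= verts S2}.
  by move=> z /(subsetP sS1.1)/(subsetP sS2.1).
have S2y1 : y1 \in verts S2 by apply: (subsetP sS2.1).
have S2y2 : y2 \in verts S2 by rewrite !inE eqxx orbT.
clearbody S2; clearbody S1.
have [|||S' [p' [ws [[fS' eS' sS' cS' p'p] [sws Uws wsP dS']]]]] := IH S2 p2 fS2 eS2.
- by apply: room_le rS; rewrite c2 c1 /=; clear; lia.
- by [].
- move=> w vw; have [Sw dw] := vsS w (mem_tl _ vw); split; first exact: S2S.
  have wv : w != v by apply: contraNneq nv => <-.
  by have := d2 _ Sw wv; move: dw; clear; lia.
have vsS' z : z \in vs -> z \in verts S by move=> vz; have [] := vsS z (mem_tl _ vz).
have nvs z : z \notin verts S -> z \notin vs by apply: contra; apply: vsS'.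
exists S', p', (y1 :: y2 :: ws); split; split=> //=.
- exact: subgraph_trans sS1 (subgraph_trans sS2 sS').
- by rewrite cS' c2 c1 mulnS addnA addn2.
- by move=> z Sz; rewrite p'p ?S2S // p2p ?p1p //; apply: (subsetP sS1.1).
- by rewrite sws mulnS.
- rewrite Uws andbT inE y12 /=; apply/andP; split; apply/negP => /wsP[_].
    by rewrite S2y1.
  by rewrite S2y2.
- move=> w; rewrite !inE => /or3P[/eqP->|/eqP->|/wsP[S'w S2w vw dw]].
  + rewrite p'p // p2p // p1y eqxx; split=> //; first exact: (subsetP sS'.1).
    have := dS' _ S2y1 (nvs _ Sy1); have := dS2 y1; have := dS1 y1.
    by rewrite (degree_notin Sy1) y1v y12 eqxx; clear; lia.
  + rewrite p'p // p2y eqxx; split=> //; first exact: (subsetP sS'.1).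
    have := dS' _ S2y2 (nvs _ Sy2'); have := dS2 y2.
    by rewrite (degree_notin Sy2) y2v eqxx; clear; lia.
  + by split=> //; [apply: contra S2w; apply: S2S | rewrite vw orbT].
- move=> z Sz; rewrite inE negb_or => /andP[zv zvs].
  by have := dS' z (S2S _ Sz) zvs; have := d2 _ Sz zv; clear; lia.
Qed.

(** The branch of a tree from [x] to the last entry of [c].  Taking for [Z] all
    that existed before the tree was grown makes branches of different trees
    disjoint. *)
Definition branch (Z : {set T}) S p x c :=
  [/\ uniq c, {subset c <= verts S :\: Z} & path (fun a b => p b == a) x c].

Lemma binary_tree S0 j S p x : forest S0 S p -> ext S -> x \in verts S ->
  degree S x + 2 <= D -> room S (2 * 2 ^ j) ->
  exists S' p' ws, [/\ forest S0 S' p', ext S', subgraph S S',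
      #|verts S'| + 2 = #|verts S| + 2 * 2 ^ j & {in verts S, p' =1 p}] /\
    [/\ size ws = 2 ^ j, uniq ws,
     {in ws, forall w, [/\ w \in verts S', degree S' w + 2 <= D &
        exists c, [/\ size c = j, last x c = w & branch (verts S) S' p' x c]]} &
     {in verts S, forall v, v != x -> degree S' v <= degree S v}].
Proof.
move=> fS eS Sx dx; elim: j => [|j IH] rS.
  exists S, p, [:: x]; split; split=> //.
  by move=> w; rewrite inE => /eqP->; split=> //; exists [::].
have [|S1 [p1 [vs [[fS1 eS1 sS1 cS1 p1p] [svs Uvs vsP dS1]]]]] := IH.
  by apply: room_le rS; rewrite expnS; lia.
have [|| S2 [p2 [ws [[fS2 eS2 sS2 cS2 p2p] [sws Uws wsP dS2]]]]] :=
  forest_level fS1 eS1 _ Uvs.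
- by apply: room_le rS; rewrite svs expnS; lia.
- by move=> v /vsP[].
exists S2, p2, ws; split; split=> //.
- exact: subgraph_trans sS2.
- by rewrite cS2 svs expnS; lia.
- by move=> z Sz; rewrite p2p ?p1p //; apply: (subsetP sS1.1).
- by rewrite sws svs expnS.
- move=> w /wsP[S2w S1w vw dw]; split=> //; first by lia.
  have [_ _ [c [sc lc [Uc cS pc]]]] := vsP _ vw.
  exists (rcons c w); split; rewrite ?size_rcons ?sc ?last_rcons //; split.
  + rewrite rcons_uniq Uc andbT; apply: contra S1w => /cS.
    by rewrite inE => /andP[].
  + move=> z; rewrite mem_rcons inE => /predU1P[->|/cS].
      by rewrite inE S2w andbT; apply: contra S1w; apply: (subsetP sS1.1).
    by rewrite !inE => /andP[-> /(subsetP sS2.1)->].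
  + rewrite rcons_path lc eqxx andbT.
    have := pc; apply: sub_in_path (allss (x :: c)); move=> a b xca xcb /eqP<-.
    rewrite p2p //; move: xcb; rewrite inE => /predU1P[->|/cS].
      exact: (subsetP sS1.1).
    by rewrite inE => /andP[].
- move=> v Sv vx; apply: leq_trans (dS1 v Sv vx); apply: dS2.
    exact: (subsetP sS1.1).
  apply/negP => /vsP[_ _ [[|z c] [_ lc [_ cS _]]]]; first by rewrite -lc eqxx in vx.
  have : v \in verts S1 :\: verts S by apply: cS; rewrite -lc /= mem_last.
  by rewrite inE Sv.
Qed.

Lemma parent_path (e : rel T) p x c : {in c, forall b, e (p b) b} ->
  path (fun a b => p b == a) x c -> path e x c.
Proof.
elim: c x => //= b c IH x cP /andP[/eqP<- pc]; rewrite cP ?mem_head //=.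
by apply: IH => // z zc; apply: cP; rewrite inE zc orbT.
Qed.

Lemma path_parent (e : rel T) p x c : path (fun a b => p b == a) x c ->
  path e x c -> {in c, forall b, e (p b) b}.
Proof.
elim: c x => //= b c IH x /andP[/eqP pb pc] /andP[exb ec] z.
by rewrite inE => /predU1P[->|]; [rewrite pb | apply: IH ec z].
Qed.

Hypothesis h0 : 0 < h.
Hypothesis mh : m <= 2 ^ h.

(** Grow binary trees of depth [h] from [x] and [y]; their last levels have at
    least [m] vertices each, so an edge joins them.  Everything outside the two
    branches leading to that edge is then pruned. *)
Lemma connect_short S x y : ext S -> x \in verts S -> y \in verts S -> x != y ->
  degree S x + 2 <= D -> degree S y + 2 <= D -> room S (4 * 2 ^ h) ->
  exists r, [/\ size r = 2 * h, uniq r, {in r, forall z, z \notin verts S},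
    path (adj G) x (rcons r y) & ext (addpath S x (rcons r y))].
Proof.
move=> eS Sx Sy nxy dx dy rS.
have [|S1 [p1 [vs [[fS1 eS1 sS1 cS1 p1p] [svs Uvs vsP dS1]]]]] :=
  binary_tree (j := h) (forest_refl S id) eS Sx dx.
  by apply: room_le rS; lia.
have S1y := subsetP sS1.1 _ Sy.
have [||S2 [p2 [ws [[fS2 eS2 sS2 cS2 p2p] [sws Uws wsP dS2]]]]] :=
  binary_tree (j := h) fS1 eS1 S1y.
- by apply: leq_trans dy; rewrite leq_add2r dS1 // eq_sym.
- by apply: room_le rS; lia.
have S1vs v : v \in vs -> v \in verts S1 by case/vsP.
have S1ws w : w \in ws -> w \in verts S2 :\: verts S1.
  case/wsP=> _ _ [[|z c] [sc lc [_ cS _]]]; first by move: h0; rewrite -sc.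
  by apply: cS; rewrite -lc /= mem_last.
have [SG2 dS2D xS2] := eS2.
have S12 := subsetP sS2.1.
have [|||||u [w [uvs wws Guw]]] := jG (A := [set z in vs]) (B := [set z in ws]) _ _ _ _ _.
- by apply/subsetP => z; rewrite inE => /S1vs/S12/(subsetP SG2.1).
- by apply/subsetP => z; rewrite inE => /S1ws; rewrite inE => /andP[_ /(subsetP SG2.1)].
- rewrite -setI_eq0; apply/eqP/setP => z; rewrite !inE; apply/negP => /andP[/S1vs S1z].
  by move/S1ws; rewrite inE S1z.
- by rewrite cardsE (card_uniqP Uvs) svs.
- by rewrite cardsE (card_uniqP Uws) sws.
move: uvs wws; rewrite !inE => uvs wws.
have [_ _ [c [sc lc [Uc cS pc]]]] := vsP _ uvs.
have [_ _ [d [sd ld [Ud dS pd]]]] := wsP _ wws.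
have {}cS z : z \in c -> z \in verts S1 /\ z \notin verts S.
  by move/cS; rewrite inE => /andP[].
have {}dS z : z \in d -> z \in verts S2 /\ z \notin verts S1.
  by move/dS; rewrite inE => /andP[].
have [_ pS2 adjS2] := fS2.
have S1S := subsetP sS1.1.
have pc2 : path (fun a b => p2 b == a) x c.
  have := pc; apply: sub_in_path (allss (x :: c)) => a b _ xcb.
  by rewrite p2p //; move: xcb; rewrite inE => /predU1P[->|/cS[]//]; apply: S1S.
have cN z : z \in c -> z \in verts S2 :\: verts S.
  by move=> /cS[zS1 zS]; rewrite inE zS S12.
have dN z : z \in d -> z \in verts S2 :\: verts S.
  by move=> /dS[zS2 zS1]; rewrite inE zS2 andbT; apply: contra zS1; apply: S1S.
have cG : path (adj G) x c.
  by apply: parent_path pc2 => b /cN/pS2; apply: SG2.2.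
have dG : path (adj G) y d.
  by apply: parent_path pd => b /dN/pS2; apply: SG2.2.
have symadj (H : graph T) a s : path (adj H) (last a s) (rev (belast a s)) = path (adj H) a s.
  by rewrite rev_path; apply: eq_path => i j; rewrite adj_sym.
have revd : rcons (rev d) y = w :: rev (belast y d).
  by rewrite -rev_cons lastI ld rev_rcons.
have qG : path (adj G) x (rcons (c ++ rev d) y).
  by rewrite rcons_cat revd cat_path cG /= lc Guw -ld symadj.
have Uq : uniq (c ++ rev d).
  rewrite cat_uniq Uc rev_uniq Ud andbT /=; apply/hasPn => z; rewrite mem_rev => /dS[_ S1z].
  by apply: contra S1z => /cS[].
have qS : {in c ++ rev d, forall z, z \notin verts S}.
  by move=> z; rewrite mem_cat mem_rev => /orP[/cN|/dN]; rewrite inE => /andP[].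
have Uxq : uniq (x :: rcons (c ++ rev d) y).
  rewrite /= mem_rcons inE negb_or nxy rcons_uniq Uq andbT /=.
  by apply/andP; split; apply/negP => /qS; rewrite ?Sx ?Sy.
exists (c ++ rev d); split=> //; first by rewrite size_cat size_rev sc sd addnn mul2n.
set q := rcons _ y in qG Uxq *; set A := addpath S x q.
have pA : path (adj A) x q by apply: path_addpath.
have [pcA pdA] : path (adj A) x c /\ path (adj A) y d.
  move: pA; rewrite /q rcons_cat revd cat_path => /andP[-> /= /andP[_]].
  by rewrite -ld symadj.
have SA : subgraph S A := sub_addpath _ _ _.
have VA : verts A = verts S :|: [set z in q] by apply: verts_addpath.
split; first by apply: addpath_subgraph => //; case: eS.
- move=> v; have [_ dSD _] := eS.
  have [Sv|Sv] := boolP (v \in verts S); last first.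
    exact: leq_trans (degree_link_new Uxq Sv) D1.
  have := degree_link_old nxy Sx qS Sv.
  case: (v =P x) => [->|_]; first by rewrite (negPf nxy) -/A; move: dx; clear; lia.
  case: (v =P y) => [->|_]; first by rewrite -/A; move: dy; clear; lia.
  by have := dSD v; rewrite -/A; clear; lia.
- have SVA : verts A \subset verts S2.
    rewrite VA subUset (subset_trans sS1.1 sS2.1) /=.
    apply/subsetP => z; rewrite !inE mem_rcons inE mem_cat mem_rev.
    by case/or3P => [/eqP->|/cS[/S12]|/dS[]//]; first exact: S12.
  have dropA z : z \in verts S2 :\: verts S -> z \in c ++ d \/ z \in verts S2 :\: verts A.
    rewrite VA !inE mem_rcons inE !mem_cat mem_rev negb_or => /andP[zS zS2].
    rewrite zS zS2 andbT /= negb_or.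
    have -> : (z == y) = false by apply: contraNF zS => /eqP->.
    by case: (_ || _); [left|right].
  have pA2 z : z \in c ++ d -> adj A (p2 z) z.
    rewrite mem_cat => /orP[]; first exact: path_parent pc2 pcA _.
    exact: path_parent pd pdA _.
  apply: (expands_prune D1 m0 (p := p2) xS2) => // [w'|a b /adjS2[Sab|[Wb eb]|[Wa ea]]].
  + rewrite inE => /andP[nA S2w']; apply: SG2.2; apply: pS2; rewrite inE S2w' andbT.
    by apply: contra nA; rewrite VA inE => ->.
  + by constructor 1; apply: SA.2.
  + by have [/pA2|] := dropA _ Wb; [rewrite eb; constructor 1 | constructor 2].
  + have [/pA2|] := dropA _ Wa; [rewrite ea adj_sym; constructor 1 | constructor 3] => //.
Qed.

(** A pendant path at [x] takes up the length in excess of [2 * h + 1]. *)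
Lemma connecting_path l S x y : ext S -> x \in verts S -> y \in verts S -> x != y ->
  degree S x + 2 <= D -> degree S y + 2 <= D -> 2 * h < l ->
  room S (l + 4 * 2 ^ h) ->
  exists r, [/\ (size r).+1 = l, uniq r, {in r, forall z, z \notin verts S},
    path (adj G) x (rcons r y) & ext (addpath S x (rcons r y))].
Proof.
move=> eS Sx Sy nxy dx dy hl rS.
pose k := l - (2 * h).+1.
(* For [k = 0] the pendant path is empty and its end is [x] itself. *)
have [||q [sq Uq qS pq eS1]] := pendant (l := k) eS _ Sx.
- by apply: room_le rS; rewrite /k; lia.
- lia.
set S1 := addpath S x q in eS1.
have V1 : verts S1 = verts S :|: [set z in q] by apply: verts_addpath.
have Uxq : uniq (x :: q) by rewrite /= Uq andbT; apply/negP => /qS; rewrite Sx.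
have S1y : y \in verts S1 by rewrite V1 inE Sy.
have S1l : last x q \in verts S1.
  by rewrite V1 !inE; have := mem_last x q; rewrite inE => /predU1P[->|->]; rewrite ?Sx ?orbT.
have lxy : last x q != y.
  have := mem_last x q; rewrite inE => /predU1P[->//|/qS].
  by apply: contraNneq => ->.
have c1 : #|verts S1| = #|verts S| + k.
  rewrite V1 cardsU (_ : _ :&: _ = set0) ?cards0 ?subn0.
    by rewrite cardsE (card_uniqP Uq) sq.
  by apply/setP => z; rewrite !inE; apply/negP => /andP[Sz /qS]; rewrite Sz.
have [|||r [sr Ur rS1 pr er]] := connect_short eS1 S1l S1y lxy.
- have := mem_last x q; rewrite inE => /predU1P[lx|lq].
    have q0 : q = [::].
      by case: (q) lx Uxq => // a q' /= <-; rewrite mem_last.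
    by rewrite /S1 q0.
  by apply: leq_trans D4; rewrite -[4]/(2 + 2) leq_add2r; apply: (degree_link_new Uxq (qS _ lq)).
- apply: leq_trans dy; rewrite leq_add2r; have := degree_pendant_old Sx qS Sy.
  by rewrite [y == x]eq_sym (negPf nxy) addn0.
- by apply: room_le rS; rewrite c1 /k; clear; lia.
exists (q ++ r); split.
- by rewrite size_cat sq sr /k; move: hl; clear; lia.
- rewrite cat_uniq Uq Ur andbT; apply/hasPn => z /rS1; rewrite V1 !inE.
  by rewrite negb_or => /andP[].
- move=> z; rewrite mem_cat => /orP[/qS//|/rS1]; rewrite V1 inE negb_or.
  by case/andP.
- by rewrite rcons_cat cat_path pq.
- by rewrite rcons_cat addpath_cat.
Qed.

End Connecting.

(** * Systems of disjoint paths *)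

Section Linkages.
Variable T : finType.
Implicit Types (S : graph T) (W : {set T}) (s : seq (T * T * nat)) (xs ys zs : seq T).

Definition walk_ends (w : T * seq T) := (w.1, last w.1 w.2, size w.2).
Definition walk_verts (ws : seq (T * seq T)) := flatten [seq w.1 :: w.2 | w <- ws].

(** The entry [(x, y, l)] of [s] asks for a path of length [l] from [x] to [y];
    the paths must partition [W].  Working up to permutation of [s] makes the
    order in which linkages are put together irrelevant. *)
Definition linked S W s := exists ws : seq (T * seq T),
  [/\ perm_eq [seq walk_ends w | w <- ws] s,
      all (fun w => path (adj S) w.1 w.2) ws,
      uniq (walk_verts ws) & walk_verts ws =i W].

Lemma linked_perm S W s s' : perm_eq s s' -> linked S W s -> linked S W s'.
Proof. by move=> ss' [ws [ws_s *]]; exists ws; split=> //; apply: perm_trans ss'. Qed.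

Lemma linked_sub S S' W s : subgraph S S' -> linked S W s -> linked S' W s.
Proof.
move=> [_ E] [ws [? wsS ? ?]]; exists ws; split=> //.
by apply: sub_all wsS => w; apply: sub_path => a b; apply: E.
Qed.

Lemma linked0 S : linked S set0 [::].
Proof. by exists [::]; split=> // z; rewrite inE. Qed.

Lemma linked_cat S W1 W2 s1 s2 : [disjoint W1 & W2] ->
  linked S W1 s1 -> linked S W2 s2 -> linked S (W1 :|: W2) (s1 ++ s2).
Proof.
move=> dW [ws1 [p1 a1 u1 e1]] [ws2 [p2 a2 u2 e2]]; exists (ws1 ++ ws2); split.
- by rewrite map_cat perm_cat.
- by rewrite all_cat a1.
- rewrite /walk_verts map_cat flatten_cat cat_uniq u1 u2 andbT /=.
  apply/hasPn => z; rewrite e1 e2 => z2; apply: contraL dW => z1.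
  by apply/pred0Pn; exists z; rewrite /= z1.
- by move=> z; rewrite /walk_verts map_cat flatten_cat mem_cat e1 e2 inE.
Qed.

Lemma linked1 S x q : path (adj S) x q -> uniq (x :: q) ->
  linked S [set z in x :: q] [:: (x, last x q, size q)].
Proof.
move=> pq Uq; exists [:: (x, q)]; split=> //=; rewrite /walk_verts /= ?cats0 ?pq //.
by move=> z; rewrite inE.
Qed.

Lemma linked_cons S W x y l s : linked S W ((x, y, l) :: s) ->
  exists q W', [/\ size q = l, last x q = y, path (adj S) x q & uniq (x :: q)] /\
    [/\ {in x :: q, forall z, z \notin W'}, W = W' :|: [set z in x :: q] & linked S W' s].
Proof.
move=> [ws [ps pa u e]].
have /mapP[[x' q] wsq [ex ey el]] : (x, y, l) \in [seq walk_ends w | w <- ws].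
  by rewrite (perm_mem ps) mem_head.
rewrite /= in ex ey el; subst x'.
have pr := perm_to_rem wsq; set ws' := rem _ ws in pr.
have pv : perm_eq (walk_verts ws) ((x :: q) ++ walk_verts ws').
  exact: (perm_flatten (perm_map (fun w => w.1 :: w.2) pr)).
move: u; rewrite (perm_uniq pv) cat_uniq => /and3P[Uq nq Uw].
move: pa; rewrite (perm_all _ pr) /= => /andP[pq pa].
exists q, [set z in walk_verts ws']; split; split=> //.
- by move=> z zq; rewrite inE; apply: contra nq => zw; apply/hasP; exists z.
- by apply/setP => z; rewrite -e (perm_mem pv) mem_cat !inE orbC.
- exists ws'; split=> // [|z]; last by rewrite inE.
  have := perm_map walk_ends pr; rewrite perm_sym /= {1}/walk_ends /= -ey -el.
  by move=> pr'; have := perm_trans pr' ps; rewrite perm_cons.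
Qed.

Lemma linked_add S W x q s : path (adj S) x q -> uniq (x :: q) ->
  {in x :: q, forall z, z \notin W} -> linked S W s ->
  linked S (W :|: [set z in x :: q]) ((x, last x q, size q) :: s).
Proof.
move=> pq Uq qW lW; rewrite setUC; apply: (linked_cat _ (linked1 pq Uq) lW).
rewrite disjoints_subset; apply/subsetP => z; rewrite !inE => zq; apply: qW.
by rewrite inE.
Qed.

Lemma linked_extend S W x y l s q : linked S W ((x, y, l) :: s) ->
  path (adj S) y q -> uniq q -> {in q, forall z, z \notin W} ->
  linked S (W :|: [set z in q]) ((x, last y q, l + size q) :: s).
Proof.
case/linked_cons => r [W' [[sr lr pr Ur] [rW' eW lW']]] pq Uq qW.
rewrite eW -setUA -(_ : [set z in x :: r ++ q] = [set z in x :: r] :|: [set z in q]); last first.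
  by apply/setP => z; rewrite !inE mem_cat orbA.
rewrite -sr -size_cat -lr -last_cat; apply: linked_add => //.
- by rewrite cat_path pr lr.
- rewrite -cat_cons cat_uniq Ur Uq andbT /=; apply/hasPn => z /qW.
  by rewrite eW inE negb_or => /andP[_]; rewrite inE.
- move=> z; rewrite -cat_cons mem_cat => /orP[/rW'//|/qW].
  by rewrite eW inE negb_or => /andP[].
Qed.

Lemma linked_extend2 S W e x y l q : linked S W [:: e; (x, y, l)] ->
  path (adj S) y q -> uniq q -> {in q, forall z, z \notin W} ->
  linked S (W :|: [set z in q]) [:: e; (x, last y q, l + size q)].
Proof.
have sw a b : perm_eq [:: a; b] [:: b; a :> T * T * nat] by rewrite (perm_catC [:: a] [:: b]).
move=> lW pq Uq qW; apply: (linked_perm (sw _ _)).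
by apply: linked_extend => //; apply: linked_perm lW.
Qed.

Lemma linked_mem S W s x y l : linked S W s -> (x, y, l) \in s -> x \in W /\ y \in W.
Proof.
move=> [ws [ps _ _ e]]; rewrite -(perm_mem ps) => /mapP[[x' q] wq [-> -> _]] /=.
by split; rewrite -e; apply/flatten_mapP; exists (x', q) => //=; rewrite ?mem_head ?mem_last.
Qed.

Definition legs l xs ys : seq (T * T * nat) := [seq (e, l) | e <- zip xs ys].

Lemma linked_legs_mem S W l xs ys : size xs = size ys -> linked S W (legs l xs ys) ->
  {subset xs <= W} /\ {subset ys <= W}.
Proof.
move=> sxy lW.
have H e : e \in zip xs ys -> e.1 \in W /\ e.2 \in W.
  case: e => x y exy; apply: (linked_mem (l := l) lW).
  by apply/mapP; exists (x, y).
split=> z; [rewrite -{1}(@unzip1_zip _ _ xs ys) ?sxy // | rewrite -{1}(@unzip2_zip _ _ xs ys) ?sxy //];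
  by move=> /mapP[e /H[? ?] ->].
Qed.

(** The two systems meet only in [ys], so every path of the first can be
    continued by the path of the second that starts at its end. *)
Lemma linked_comp S W1 W2 l1 l2 xs ys zs : size xs = size ys -> size ys = size zs ->
  W1 :&: W2 = [set z in ys] ->
  linked S W1 (legs l1 xs ys) -> linked S W2 (legs l2 ys zs) ->
  linked S (W1 :|: W2) (legs (l1 + l2) xs zs).
Proof.
elim: ys xs zs W1 W2 => [|y ys IH] [|x xs] [|z zs] W1 W2 //.
  move=> _ _ WI lW1 lW2; apply: (linked_cat (s1 := [::]) (s2 := [::])) => //.
  by rewrite -setI_eq0 WI; apply/eqP/setP => z; rewrite !inE.
move=> [sxy] [syz] WI; rewrite /legs /=.
case/linked_cons => q1 [W1' [[sq1 lq1 pq1 Uq1] [qW1 eW1 lW1]]].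
case/linked_cons => q2 [W2' [[sq2 lq2 pq2 Uq2] [qW2 eW2 lW2]]].
have [_ ys1] := linked_legs_mem sxy lW1.
have [ys2 _] := linked_legs_mem syz lW2.
have yq1 : y \in x :: q1 by rewrite -lq1 mem_last.
have both v : v \in W1 -> v \in W2 -> v = y \/ v \in W1' /\ v \in W2'.
  move=> v1 v2; have : v \in W1 :&: W2 by rewrite inE v1.
  by rewrite WI !inE => /predU1P[|yv]; [left | right; rewrite ys1 ?ys2].
have W1q v : v \in x :: q1 -> v \in W1 by rewrite eW1 !inE => ->; rewrite orbT.
have W2q v : v \in y :: q2 -> v \in W2 by rewrite eW2 !inE => ->; rewrite orbT.
have W1s v : v \in W1' -> v \in W1 by rewrite eW1 !inE => ->.
have W2s v : v \in W2' -> v \in W2 by rewrite eW2 !inE => ->.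
have yW1 := qW1 _ yq1; have yW2 := qW2 _ (mem_head y q2).
have [yq2 Uq2'] : y \notin q2 /\ uniq q2 by apply/andP.
have q12 v : v \in x :: q1 -> v \notin q2.
  move=> v1; apply/negP => v2; have v2' : v \in y :: q2 by rewrite inE v2 orbT.
  case: (both v (W1q _ v1) (W2q _ v2')) => [ev|[vW1 _]].
    by rewrite -ev v2 in yq2.
  by have := qW1 _ v1; rewrite vW1.
have -> : W1 :|: W2 = (W1' :|: W2') :|: [set z in x :: q1 ++ q2].
  rewrite eW1 eW2; apply/setP => v; rewrite !inE !mem_cat.
  case: (v =P y) => [->|_]; first by move: yq1; rewrite inE => /orP[]->; rewrite !orbT.
  by case: (v \in W1'); case: (v \in W2'); case: (v == x); case: (v \in q1).
rewrite -sq1 -sq2 -size_cat -lq2 -lq1 -last_cat; apply: linked_add.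
- by rewrite cat_path pq1 lq1.
- rewrite -cat_cons cat_uniq Uq1 Uq2' andbT /=.
  by apply/hasPn => v v2; apply: contraL v2; apply: q12.
- move=> v; rewrite -cat_cons mem_cat in_setU negb_or => /orP[v1|v2].
    rewrite qW1 //=; apply/negP => v2; case: (both v (W1q _ v1) (W2s _ v2)).
      by move=> ev; rewrite ev (negPf yW2) in v2.
    by case=> vW1 _; have := qW1 _ v1; rewrite vW1.
  have v2' : v \in y :: q2 by rewrite inE v2 orbT.
  rewrite qW2 // andbT; apply/negP => v1; case: (both v (W1s _ v1) (W2q _ v2')).
    by move=> ev; rewrite ev (negPf yW1) in v1.
  by case=> _ vW2; have := qW2 _ v2'; rewrite vW2.
- rewrite size_cat sq1 sq2; apply: IH => //; apply/setP => v; rewrite !inE.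
  apply/andP/idP => [[v1 v2]|yv]; last by rewrite ys1 ?ys2.
  have : v \in W1 :&: W2 by rewrite inE W1s ?W2s.
  by rewrite WI !inE => /predU1P[ev|//]; rewrite ev (negPf yW1) in v1.
Qed.

End Linkages.

(** * The switch *)

Section Switches.
Variables (T : finType) (G : graph T) (D m h : nat).
Implicit Types (S : graph T) (U W : {set T}) (q : seq T).
Hypothesis jG : joined m G.
Hypothesis D5 : 5 <= D.
Hypothesis m0 : 0 < m.
Hypothesis h0 : 0 < h.
Hypothesis mh : m <= 2 ^ h.

Local Notation ext := (nat_extendable G D m).

Let D4 : 4 <= D. Proof. exact: ltnW. Qed.

(** The slack [4 * 2 ^ h] is the space taken by the trees of [connecting_path] before
    they are pruned. *)
Definition roomy S k := room G D m S (k + 4 * 2 ^ h).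

Lemma roomy_le S S' k k' : #|verts S'| + k' <= #|verts S| + k -> roomy S k -> roomy S' k'.
Proof. by rewrite /roomy /room; clear; lia. Qed.

(** [S'] is [S] with a path drawn in it.  As [q] lists the new vertices only,
    paths ending at a new vertex and paths ending in [S] are treated alike. *)
Record adds S S' q : Prop := Adds {
  adds_ext : ext S';
  adds_sub : subgraph S S';
  adds_uniq : uniq q;
  adds_new : {in q, forall z, z \notin verts S};
  adds_verts : verts S' = verts S :|: [set z in q];
  adds_degree : {in q, forall z, degree S' z <= 2} }.

Lemma adds_card S S' q : adds S S' q -> #|verts S'| = #|verts S| + size q.
Proof.
case=> _ _ Uq qS -> _; rewrite cardsU (_ : _ :&: _ = set0) ?cards0 ?subn0.
  by rewrite cardsE (card_uniqP Uq).
by apply/setP => z; rewrite !inE; apply/negP => /andP[Sz /qS]; rewrite Sz.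
Qed.

Lemma addpath_adds S x q r : ext (addpath S x r) -> uniq (x :: r) -> uniq q ->
  x \in verts S -> {in q, forall z, z \notin verts S} ->
  verts S :|: [set z in r] = verts S :|: [set z in q] -> adds S (addpath S x r) q.
Proof.
move=> eS Uxr Uq Sx qS rq; split=> //; first exact: sub_addpath.
  by rewrite verts_addpath.
by move=> z /qS; apply: degree_link_new.
Qed.

Lemma attach S x l : ext S -> roomy S l -> x \in verts S -> degree S x + 2 <= D ->
  exists q S', [/\ adds S S' q, size q = l, path (adj S') x q,
     0 < l -> degree S' (last x q) <= 1 &
     {in verts S, forall v, degree S' v <= degree S v + (v == x)}].
Proof.
move=> eS rS Sx dx.
have dx1 : degree S x < D by move: dx; clear; lia.
have [|q [sq Uq qS _ eS']] := pendant jG D4 m0 (l := l) eS _ Sx dx1.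
  by move: rS; rewrite /roomy /room; clear; lia.
have Uxq : uniq (x :: q) by rewrite /= Uq andbT; apply/negP => /qS; rewrite Sx.
exists q, (addpath S x q); split=> //.
- exact: addpath_adds.
- exact: path_addpath.
- move=> l0; apply: degree_pendant_last => //; apply: qS.
  by case: (q) sq l0 => [<-//|z q' _ _ /=]; apply: mem_last.
- by move=> v Sv; apply: degree_pendant_old.
Qed.

Lemma bridge S x y l : ext S -> roomy S l -> x \in verts S -> y \in verts S -> x != y ->
  degree S x + 2 <= D -> degree S y + 2 <= D -> 2 * h < l ->
  exists q S', [/\ adds S S' q, (size q).+1 = l, path (adj S') x (rcons q y) &
     {in verts S, forall v, degree S' v <= degree S v + (v == x) + (v == y)}].
Proof.
move=> eS rS Sx Sy nxy dx dy hl.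
have [q [sq Uq qS _ eS']] := connecting_path jG D4 m0 h0 mh eS Sx Sy nxy dx dy hl rS.
have Uxq : uniq (x :: rcons q y).
  rewrite /= mem_rcons inE negb_or nxy rcons_uniq Uq andbT /=.
  by apply/andP; split; apply/negP => /qS; rewrite ?Sx ?Sy.
exists q, (addpath S x (rcons q y)); split=> //.
- apply: addpath_adds => //; apply/setP => z; rewrite !inE mem_rcons inE.
  by case: eqP => [->|]; rewrite ?Sy.
- exact: path_addpath.
- by move=> v Sv; apply: degree_link_old.
Qed.

(** The part of the switch beyond [p1].  The entries [p], [q], [p'], [q'] and
    [rest] are what is left of the cycle [p1 q1 p2 q2 .. pk qk], and the path
    system drawn so far covers [W].  In one setting the paths from [a] and [b]
    have reached [p] and [p']; in the other [a] still waits at [r], which is [p1],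
    and [b] has reached [p'].  One round joins [q] and [q'] to the next two [p]'s by
    paths of length [w]: in the first setting the path at [p] goes on through
    [q] and that at [p'] through [q']; in the second the path at [p'] takes the
    edge [p' q], arrives at the next [p], and takes its edge to [q'].  At the
    end [q] and [q'] get pendant paths to [c] and [d], and [a] leaves through the
    edge [r q'] that closes the cycle. *)
Lemma ladder (g : nat) S (p q p' q' : T) (rest : seq T) W
    (l1 l2 l3 x X : nat) (a b r : T) :
  let w := (2 * h).+1 in
  size rest = 4 * g -> ext S -> roomy S (4 * (g * h) + w + X) -> 0 < X ->
  uniq [:: p, q, p', q' & rest] -> {subset [:: p, q, p', q' & rest] <= verts S} ->
  path (adj S) p [:: q, p', q' & rest] -> adj S r (last q' rest) ->
  {in [:: q, q' & rest], forall z, degree S z <= 2} ->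
  W \subset verts S -> p \in W -> p' \in W ->
  {in [:: q, q' & rest], forall z, z \notin W} ->
  linked S W [:: (a, p, l1); (b, p', l2)] -> linked S W [:: (a, r, x); (b, p', l3)] ->
  exists S' c d, [/\ ext S', subgraph S S',
     #|verts S'| = #|verts S| + (4 * (g * h) + w + X) &
     {in verts S, forall v, v \notin [:: q, q' & rest] -> degree S' v <= degree S v}] /\
   [/\ c \in verts S' :\: verts S, d \in verts S' :\: verts S, c != d,
     degree S' c <= 1 & degree S' d <= 1] /\
   let R := W :|: [set z in [:: p, q, p', q' & rest]] :|: (verts S' :\: verts S) in
   linked S' R [:: (a, c, l1 + g * w.+1 + 1 + w); (b, d, l2 + g * w.+1 + 1 + X)] /\
   linked S' R [:: (a, d, x + 1 + X); (b, c, l3 + 2 * (g * w.+1) + 1 + w)].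
Proof.
move=> w; elim: g S p q p' q' rest W l1 l2 l3 => [|g IH] S p q p' q' rest W l1 l2 l3.
  move=> /eqP; rewrite muln0 size_eq0 => /eqP-> eS rS X0.
  rewrite /= !inE !negb_or !andbT => /andP[/and3P[npq npp' npq'] /andP[/andP[nqp' nqq'] np'q']].
  move=> csS /and3P[apq aqp' ap'q'] arq' dle WS pW p'W csW lk1 lk2.
  have [Sp Sq Sp' Sq'] : [/\ p \in verts S, q \in verts S, p' \in verts S & q' \in verts S].
    by split; apply: csS; rewrite !inE eqxx ?orbT.
  have qW : q \notin W by apply: csW; rewrite !inE eqxx.
  have q'W : q' \notin W by apply: csW; rewrite !inE eqxx orbT.
  have dq : degree S q <= 2 by apply: dle; rewrite !inE eqxx.
  have dq' : degree S q' <= 2 by apply: dle; rewrite !inE eqxx orbT.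
  have [||qc [S1 [a1 s1 p1 d1 D1]]] := attach (x := q) (l := w) eS _ Sq.
  - by apply: roomy_le rS; clear; lia.
  - by move: dq D5; clear; lia.
  have S1q' : q' \in verts S1 by apply: (subsetP (adds_sub a1).1).
  have [||qd [S2 [a2 s2 p2 d2 D2]]] := attach (x := q') (l := X) (adds_ext a1) _ S1q'.
  - by apply: roomy_le rS; rewrite (adds_card a1) s1; clear; lia.
  - by have := D1 _ Sq'; rewrite [q' == q]eq_sym (negPf nqq'); move: dq' D5; clear; lia.
  have [w0 sub12] : 0 < w /\ subgraph S S2.
    by split=> //; apply: subgraph_trans (adds_sub a1) (adds_sub a2).
  set c := last q qc; set d := last q' qd.
  have cq : c \in qc by rewrite /c; case: (qc) s1 => // z s _ /=; apply: mem_last.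
  have dq2 : d \in qd by rewrite /d; case: (qd) s2 X0 => [<-//|z s _ _ /=]; apply: mem_last.
  have cS := adds_new a1 cq; have S1c : c \in verts S1 by rewrite (adds_verts a1) !inE cq orbT.
  have dS1 := adds_new a2 dq2.
  have dS : d \notin verts S by apply: contra dS1; apply: (subsetP (adds_sub a1).1).
  have V2 : verts S2 = verts S :|: [set z in qc] :|: [set z in qd].
    by rewrite (adds_verts a2) (adds_verts a1).
  have newc z : z \in qc -> z \notin W.
    by move=> /(adds_new a1); apply: contra; apply: (subsetP WS).
  have newd z : z \in qd -> z \notin verts S /\ z \notin qc.
    by move=> /(adds_new a2); rewrite (adds_verts a1) !inE negb_or => /andP[].
  have newd' z : z \in qd -> z \notin W.
    by move=> /newd[+ _]; apply: contra; apply: (subsetP WS).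
  have Uqc : uniq (q :: qc).
    by rewrite /= (adds_uniq a1) andbT; apply/negP => /(adds_new a1); rewrite Sq.
  have Uqd : uniq (q' :: qd).
    by rewrite /= (adds_uniq a2) andbT; apply/negP => /(adds_new a2); rewrite S1q'.
  have nc : {in q :: qc, forall z, z \notin W} by move=> z; rewrite inE => /predU1P[->|/newc].
  have nd : {in q' :: qd, forall z, z \notin W} by move=> z; rewrite inE => /predU1P[->|/newd'].
  have nd' : {in q' :: qd, forall z, z \notin q :: qc}.
    move=> z; rewrite !inE negb_or => /predU1P[->|/newd[zS ->]].
      rewrite eq_sym nqq' /=; apply/negP => /(adds_new a1); by rewrite Sq'.
    by rewrite andbT; apply: contraNneq zS => ->.
  have [pc pd] : path (adj S2) q qc /\ path (adj S2) q' qd.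
    by split=> //; apply: sub_path p1 => i j; apply: (adds_sub a2).2.
  (* The cycle is exhausted: draw the paths to [c] and [d]. *)
  have R_eq : W :|: [set z in q :: qc] :|: [set z in q' :: qd] =
      W :|: [set z in [:: p; q; p'; q']] :|: (verts S2 :\: verts S).
    apply/setP => z; rewrite V2 !inE.
    case: (z =P p) => [->|_]; first by rewrite pW.
    case: (z =P p') => [->|_]; first by rewrite p'W.
    have [Sz|Sz] := boolP (z \in verts S).
      have -> : z \in qc = false by apply/negP => /(adds_new a1); rewrite Sz.
      have -> : z \in qd = false by apply/negP => /newd[]; rewrite Sz.
      by case: (z \in W); case: (z == q); case: (z == q').
    by case: (z \in W); case: (z == q); case: (z \in qc); case: (z == q'); case: (z \in qd).
  exists S2, c, d; split; [split | split; [split|]].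
  - exact: adds_ext a2.
  - by [].
  - by rewrite (adds_card a2) (adds_card a1) s1 s2; clear; lia.
  - move=> v Sv; rewrite !inE negb_or => /andP[/negPf vq /negPf vq'].
    have := D1 v Sv; have := D2 v (subsetP (adds_sub a1).1 v Sv).
    by rewrite vq vq' !addn0 => /leq_trans; apply.
  - by rewrite V2 !inE cS cq orbT.
  - by rewrite V2 !inE dS dq2 orbT.
  - by apply: contraNneq dS1 => <-.
  - have := D2 _ S1c; rewrite (_ : (c == q') = false) ?addn0; last first.
      by apply: contraNF cS => /eqP->.
    by move=> /leq_trans; apply; apply: d1.
  - exact: d2.
  rewrite muln0 mul0n !addn0 -R_eq /=; split.
  - rewrite -!addnA -s1 -s2 !add1n.
    apply: (linked_extend2 (y := p') (q := q' :: qd)) => //=; last 2 first.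
    + by rewrite pd andbT; apply: sub12.2.
    + by move=> z zd; rewrite in_setU negb_or nd // inE nd'.
    apply: (linked_extend (y := p) (q := q :: qc)) => //=; last by rewrite pc andbT; apply: sub12.2.
    exact: linked_sub lk1.
  - rewrite -!addnA -s1 -s2 !add1n setUAC.
    apply: (linked_extend2 (y := p') (q := q :: qc)) => //=; last 2 first.
    + by rewrite pc andbT adj_sym; apply: sub12.2.
    + move=> z zc; rewrite in_setU negb_or nc // inE.
      by apply: contraL zc; apply: nd'.
    apply: (linked_extend (y := r) (q := q' :: qd)) => //=; last by rewrite pd andbT; apply: sub12.2.
    exact: linked_sub lk2.
case: rest => [|p2 [|q2 [|p3 [|q3 rest]]]]; rewrite mulnS // => -[srest].
move=> eS rS X0 U csS pcs arq dle WS pW p'W csW lk1 lk2.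
have [nq nq' np2 np3 U4] : [/\ q \notin [:: p', q', p2, q2, p3, q3 & rest],
    q' \notin [:: p2, q2, p3, q3 & rest], p2 \notin [:: q2, p3, q3 & rest],
    p3 \notin [:: q3 & rest] & uniq [:: p2, q2, p3, q3 & rest]].
  by case/andP: U => _ /andP[-> /andP[_ /andP[-> U4]]]; split=> //;
     case/and4P: U4.
have nq2 : q2 \notin [:: p3, q3 & rest] by case/and3P: U4.
have neq (u z : T) (s1 s2 : seq T) : u \notin s1 -> {subset s2 <= s1} -> z \in s2 -> (z == u) = false.
  by move=> us1 s21 zs2; apply: contraNF us1 => /eqP<-; apply: s21.
pose new := [:: q2, q3 & rest].
have newN z : z \in new -> [/\ (z == q) = false, (z == q') = false, (z == p2) = false & (z == p3) = false].
  move=> zn; split; [apply: neq nq _ zn|apply: neq nq' _ zn|apply: neq np2 _ zn|].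
  - by move=> v; rewrite !inE => /or3P[]->; rewrite ?orbT.
  - by move=> v; rewrite !inE => /or3P[]->; rewrite ?orbT.
  - by move=> v; rewrite !inE => /or3P[]->; rewrite ?orbT.
  - move: zn; rewrite inE => /predU1P[->|]; last by apply: neq np3 _.
    by apply: contraNF nq2 => /eqP->; rewrite mem_head.
have newS z : z \in new -> z \in [:: q, q', p2, q2, p3, q3 & rest].
  by rewrite !inE => /or3P[]->; rewrite ?orbT.
have midS z : z \in [:: q, q', p2, q2, p3, q3 & rest] -> z \in verts S.
  by move=> zc; apply: csS; move: zc; rewrite !inE => /or4P[->|->|->|/or4P[]->]; rewrite ?orbT.
have mq : q \in [:: q, q', p2, q2, p3, q3 & rest] by rewrite mem_head.
have mq' : q' \in [:: q, q', p2, q2, p3, q3 & rest] by rewrite !inE eqxx orbT.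
have mp2 : p2 \in [:: q, q', p2, q2, p3, q3 & rest] by rewrite !inE eqxx ?orbT.
have mp3 : p3 \in [:: q, q', p2, q2, p3, q3 & rest] by rewrite !inE eqxx ?orbT.
have qp2 : (q == p2) = false by apply: contraNF nq => /eqP->; rewrite !inE eqxx ?orbT.
have qq' : (q == q') = false by apply: contraNF nq => /eqP->; rewrite !inE eqxx ?orbT.
have qp3 : (q == p3) = false by apply: contraNF nq => /eqP->; rewrite !inE eqxx ?orbT.
have q'p2 : (q' == p2) = false by apply: contraNF nq' => /eqP->; rewrite !inE eqxx ?orbT.
have q'p3 : (q' == p3) = false by apply: contraNF nq' => /eqP->; rewrite !inE eqxx ?orbT.
have p23 : (p2 == p3) = false by apply: contraNF np2 => /eqP->; rewrite !inE eqxx ?orbT.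
have hw : 2 * h < w by [].
have [||||s1 [S1 [a1 z1 pt1 D1]]] := bridge (y := p2) (l := w) eS _ (midS _ mq) (midS _ mp2) (negbT qp2).
- by apply: roomy_le rS; clear; lia.
- by have := dle _ mq; move: D5; clear; lia.
- by have := dle _ mp2; move: D5; clear; lia.
- by [].
have S1S := subsetP (adds_sub a1).1.
have c1 : #|verts S1| = #|verts S| + 2 * h by rewrite (adds_card a1); congr (_ + _); case: z1.
have [||||s2 [S2 [a2 z2 pt2 D2]]] := bridge (y := p3) (l := w) (adds_ext a1) _
    (S1S _ (midS _ mq')) (S1S _ (midS _ mp3)) (negbT q'p3).
- by apply: roomy_le rS; rewrite c1 mulSn /w; clear; lia.
- have := D1 _ (midS _ mq'); rewrite [q' == q]eq_sym qq' q'p2.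
  by have := dle _ mq'; move: D5; clear; lia.
- have := D1 _ (midS _ mp3); rewrite [p3 == q]eq_sym qp3 [p3 == p2]eq_sym p23.
  by have := dle _ mp3; move: D5; clear; lia.
- by [].
have c2 : #|verts S2| = #|verts S| + 4 * h.
  have e2 : size s2 = 2 * h by case: z2.
  by rewrite (adds_card a2) c1 e2; clear; lia.
have sub02 : subgraph S S2 := subgraph_trans (adds_sub a1) (adds_sub a2).
have S2S := subsetP sub02.1.
have V2 : verts S2 = verts S :|: [set z in s1] :|: [set z in s2].
  by rewrite (adds_verts a2) (adds_verts a1).
have s1S z : z \in s1 -> z \notin verts S by apply: adds_new a1 _.
have s2S z : z \in s2 -> z \notin verts S /\ z \notin s1.
  by move=> /(adds_new a2); rewrite (adds_verts a1) !inE negb_or => /andP[].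
have D12 v : v \in verts S -> degree S2 v <=
    degree S v + (v == q) + (v == p2) + (v == q') + (v == p3).
  by move=> Sv; have := D2 v (S1S _ Sv); have := D1 v Sv; clear; lia.
pose e1 := q :: rcons s1 p2; pose e2 := q' :: rcons s2 p3.
have inE1 z : z \in e1 = [|| z == q, z == p2 | z \in s1] by rewrite inE mem_rcons inE.
have inE2 z : z \in e2 = [|| z == q', z == p3 | z \in s2] by rewrite inE mem_rcons inE.
have eW1 : {in e1, forall z, z \notin W}.
  move=> z; rewrite inE1 => /or3P[/eqP->|/eqP->|/s1S zS].
  - exact: csW mq.
  - exact: csW mp2.
  - by apply: contra zS; apply: (subsetP WS).
have eW2 : {in e2, forall z, z \notin W}.
  move=> z; rewrite inE2 => /or3P[/eqP->|/eqP->|/s2S[zS _]].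
  - exact: csW mq'.
  - exact: csW mp3.
  - by apply: contra zS; apply: (subsetP WS).
have e12 : {in e2, forall z, z \notin e1}.
  move=> z; rewrite inE2 inE1 => /or3P[/eqP->|/eqP->|/s2S[zS zs1]].
  - rewrite [q' == q]eq_sym qq' q'p2 /=; apply/negP => /s1S.
    by rewrite midS.
  - rewrite [p3 == q]eq_sym qp3 [p3 == p2]eq_sym p23 /=; apply/negP => /s1S.
    by rewrite midS.
  - rewrite !negb_or zs1 andbT; apply/andP; split; apply: contraNneq zS => ->; exact: midS.
have Ue1 : uniq e1.
  rewrite /= mem_rcons inE qp2 /= rcons_uniq (adds_uniq a1) andbT.
  by apply/andP; split; apply/negP => /s1S; rewrite midS.
have Ue2 : uniq e2.
  rewrite /= mem_rcons inE q'p3 /= rcons_uniq (adds_uniq a2) andbT.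
  by apply/andP; split; apply/negP => /s2S[]; rewrite midS.
have [apq [aqp' [ap'q' [aq'p2 pt]]]] : adj S p q /\ adj S q p' /\ adj S p' q' /\ adj S q' p2 /\
    path (adj S) p2 [:: q2, p3, q3 & rest].
  by case/andP: pcs => ? /andP[? /andP[? /andP[? ?]]].
have pt1' : path (adj S2) q (rcons s1 p2).
  by apply: sub_path pt1 => i j; apply: (adds_sub a2).2.
have zl1 : size e1 = w.+1 by rewrite /= size_rcons z1.
have zl2 : size e2 = w.+1 by rewrite /= size_rcons z2.
pose W2 := W :|: [set z in e1] :|: [set z in e2].
have U2N z : z \in e2 -> z \notin W :|: [set z in e1].
  by move=> ze; rewrite in_setU negb_or eW2 //= inE e12.
have lk1' : linked S2 W2 [:: (a, p2, l1 + w.+1); (b, p3, l2 + w.+1)].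
  have := linked_extend (linked_sub sub02 lk1) (q := e1).
  rewrite zl1 /= last_rcons pt1' andbT => /(_ (sub02.2 _ _ apq) Ue1 eW1) lk.
  have := linked_extend2 lk (q := e2).
  by rewrite zl2 /= last_rcons pt2 andbT => /(_ (sub02.2 _ _ ap'q') Ue2 U2N).
have lk2' : linked S2 W2 [:: (a, r, x); (b, p3, l3 + w.+1 + w.+1)].
  have := linked_extend2 (linked_sub sub02 lk2) (q := e1).
  rewrite zl1 /= last_rcons pt1' andbT adj_sym => /(_ (sub02.2 _ _ aqp') Ue1 eW1) lk.
  have := linked_extend2 lk (q := e2).
  by rewrite zl2 /= last_rcons pt2 andbT adj_sym => /(_ (sub02.2 _ _ aq'p2) Ue2 U2N).
have := IH S2 p2 q2 p3 q3 rest W2 (l1 + w.+1) (l2 + w.+1) (l3 + w.+1 + w.+1).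
case=> //.
- exact: adds_ext a2.
- by apply: roomy_le rS; rewrite c2 mulSn; clear; lia.
- move=> z zc; apply: S2S; apply: csS; move: zc; rewrite !inE.
  by case/or4P=> [->|->|->|/orP[]->]; rewrite ?orbT.
- by apply: sub_path pt => i j; apply: sub02.2.
- exact: sub02.2.
- move=> z zn; have [n1 n2 n3 n4] := newN _ zn; have := D12 z (midS _ (newS _ zn)).
  by rewrite n1 n2 n3 n4 !addn0 => /leq_trans; apply; apply: dle (newS _ zn).
- apply/subsetP => z; rewrite !in_setU => /orP[/orP[/(subsetP WS)/S2S//|]|]; rewrite inE.
    by rewrite inE1 V2 !inE => /or3P[/eqP->|/eqP->|->];
       rewrite ?(midS _ mq) ?(midS _ mp2) ?orbT.
  by rewrite inE2 V2 !inE => /or3P[/eqP->|/eqP->|->];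
     rewrite ?(midS _ mq') ?(midS _ mp3) ?orbT.
- by rewrite !in_setU [p2 \in [set z in e1]]inE inE1 eqxx ?orbT.
- by rewrite !in_setU [p3 \in [set z in e2]]inE inE2 eqxx ?orbT.
- move=> z zn; rewrite !in_setU !negb_or; have [n1 n2 n3 n4] := newN _ zn.
  rewrite csW ?newS //= ![_ \in [set _ in _]]inE inE1 inE2 n1 n2 n3 n4 /=.
  have Sz := midS _ (newS _ zn).
  by apply/andP; split; apply/negP; [move=> /s1S | move=> /s2S[]]; rewrite Sz.
move=> S' [c [d [[eS' sS' cS' dS'] [[cN dN ncd dc dd] [lc ld]]]]].
have outN z : z \in verts S' :\: verts S2 -> z \in verts S' :\: verts S.
  by rewrite !inE => /andP[zS2 ->]; rewrite andbT; apply: contra zS2; apply: S2S.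
exists S', c, d; split; [split|split; [split=> //; exact: outN|]].
- exact: eS'.
- exact: subgraph_trans sub02 sS'.
- by rewrite cS' c2 mulSn; clear; lia.
- move=> v Sv; rewrite !inE !negb_or => /and4P[/negPf vq /negPf vq' /negPf vp2].
  move=> /and4P[vq2 /negPf vp3 vq3 vr].
  apply: (leq_trans (dS' v (S2S _ Sv) _)); first by rewrite !inE !negb_or vq2 vq3.
  by have := D12 v Sv; rewrite vq vq' vp2 vp3 !addn0.
have eR : W2 :|: [set z in [:: p2, q2, p3, q3 & rest]] :|: (verts S' :\: verts S2) =
    W :|: [set z in [:: p, q, p', q', p2, q2, p3, q3 & rest]] :|: (verts S' :\: verts S).
  apply/setP => z; rewrite !in_setU !in_setD ![_ \in [set _ in _]]inE inE1 inE2 V2 !inE.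
  case: (z =P p) => [->|_]; first by rewrite pW.
  case: (z =P p') => [->|_]; first by rewrite p'W.
  have S'12 : z \in s1 \/ z \in s2 -> z \in verts S'.
    by move=> zs; apply: (subsetP sS'.1); rewrite V2 !inE; case: zs => ->; rewrite ?orbT.
  have [Sz|Sz] := boolP (z \in verts S).
    have -> : z \in s1 = false by apply/negP => /s1S; rewrite Sz.
    have -> : z \in s2 = false by apply/negP => /s2S[]; rewrite Sz.
    by case: (z \in W); case: (z == q); case: (z == q'); case: (z == p2); case: (z == q2);
       case: (z == p3); case: (z == q3); case: (z \in rest).
  case: (boolP (z \in s1)) => zs1; first by rewrite S'12 ?orbT //; left.
  case: (boolP (z \in s2)) => zs2; first by rewrite S'12 ?orbT //; right.
  by case: (z \in W); case: (z == q); case: (z == q'); case: (z == p2); case: (z == q2);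
       case: (z == p3); case: (z == q3); case: (z \in rest).
rewrite /= -eR; split.
- by rewrite !mulSn ![_ + (w.+1 + _)]addnA; exact: lc.
- have -> : l3 + 2 * (g.+1 * w.+1) = l3 + w.+1 + w.+1 + 2 * (g * w.+1).
    by rewrite [g.+1 * _]mulSn; move: (g * _); clear=> ?; lia.
  exact: ld.
Qed.

End Switches.

(** * Composing stages of a network *)

Section Stages.
Variables (T : finType) (G : graph T) (D m : nat).
Implicit Types (S : graph T) (xs ys : seq T).

(** [S'] extends [S] by a piece of a network with inputs [xs] and outputs [ys],
    drawn so that paths of length [l] from [xs] to [ys] can cover it.  Outputs
    may be inputs, as in the empty piece of depth 0. *)
Record stage S S' xs ys l : Prop := Stage {
  stage_ext : nat_extendable G D m S';
  stage_sub : subgraph S S';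
  stage_size : size ys = size xs;
  stage_uniq : uniq ys;
  stage_out : {in ys, forall y, y \in verts S' /\ degree S' y <= 1};
  stage_new : {in ys, forall y, y \in xs \/ y \notin verts S};
  stage_old : {in verts S, forall v, v \notin xs -> degree S' v <= degree S v};
  stage_card : #|verts S'| = #|verts S| + size xs * l }.

(** What the paths through a stage have to cover.  Outputs of a stage are inputs
    of the next one, hence consecutive regions share exactly these. *)
Definition region S S' xs := (verts S' :\: verts S) :|: [set z in xs].

Lemma stage_refl S xs : nat_extendable G D m S -> uniq xs ->
  {in xs, forall x, x \in verts S /\ degree S x <= 1} -> stage S S xs xs 0.
Proof. by move=> eS Ux xS; split=> //; [move=> y; left | rewrite muln0 addn0]. Qed.

Lemma stage_trans S1 S2 S3 xs ys zs l1 l2 :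
  stage S1 S2 xs ys l1 -> stage S2 S3 ys zs l2 -> stage S1 S3 xs zs (l1 + l2).
Proof.
case=> e12 s12 z12 u12 o12 n12 d12 c12 [e23 s23 z23 u23 o23 n23 d23 c23].
have S12 := subsetP s12.1.
split=> //; first exact: subgraph_trans s23.
- by rewrite z23.
- move=> z /n23[/n12//|zS2]; right; apply: contra zS2; exact: S12.
- move=> v Sv vx; apply: leq_trans (d12 v Sv vx); apply: d23; first exact: S12.
  by apply/negP => /n12[]; rewrite ?(negPf vx) ?Sv.
- by rewrite c23 c12 z12 mulnDr addnA.
Qed.

Lemma region_trans S1 S2 S3 xs ys zs l1 l2 :
  stage S1 S2 xs ys l1 -> stage S2 S3 ys zs l2 -> {subset xs <= verts S1} ->
  region S1 S3 xs = region S1 S2 xs :|: region S2 S3 ys /\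
  region S1 S2 xs :&: region S2 S3 ys = [set z in ys].
Proof.
move=> st1 st2 xS; have S12 := subsetP (stage_sub st1).1.
have S23 := subsetP (stage_sub st2).1.
have ys12 z : z \in ys -> z \in region S1 S2 xs.
  move=> zy; have [zS2 _] := stage_out st1 zy; rewrite !inE zS2 andbT.
  by case: (stage_new st1 zy) => [->|->]; rewrite ?orbT.
split; apply/setP => z; last first.
  rewrite in_setI [z \in [set _ in _]]inE.
  apply/andP/idP => [[z1]|zy]; last by rewrite ys12 //= !inE zy orbT.
  rewrite !inE => /orP[/andP[zS2 _]|//].
  move: z1; rewrite !inE (negPf zS2) andbF /= => /xS/S12.
  by rewrite (negPf zS2).
have := ys12 z; rewrite !inE; have [zy|zy] := boolP (z \in ys).
  move=> /(_ isT); rewrite orbT orbT; case/orP => [/andP[-> zS2]|->]; rewrite ?orbT //.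
  by rewrite (S23 _ zS2).
move=> _; rewrite orbF.
have [zS1|zS1] := boolP (z \in verts S1); first by rewrite (S12 _ zS1) /= orbF.
have [zS2|zS2] := boolP (z \in verts S2); first by rewrite (S23 _ zS2).
by rewrite /= orbC.
Qed.

Lemma stage_par S1 S2 S3 xs1 xs2 ys1 ys2 l :
  stage S1 S2 xs1 ys1 l -> stage S2 S3 xs2 ys2 l ->
  uniq (xs1 ++ xs2) -> {subset xs1 ++ xs2 <= verts S1} ->
  stage S1 S3 (xs1 ++ xs2) (ys1 ++ ys2) l.
Proof.
case=> e12 s12 z12 u12 o12 n12 d12 c12 [e23 s23 z23 u23 o23 n23 d23 c23] Ux xS.
have S12 := subsetP s12.1; have S23 := subsetP s23.1.
have x1S z : z \in xs1 -> z \in verts S1 by move=> zx; apply: xS; rewrite mem_cat zx.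
have x2S z : z \in xs2 -> z \in verts S1 by move=> zx; apply: xS; rewrite mem_cat zx orbT.
move: Ux; rewrite cat_uniq => /and3P[_ nx _].
have nx12 z : z \in xs1 -> z \notin xs2.
  by move=> z1; apply: contra nx => z2; apply/hasP; exists z.
have ys1N z : z \in ys1 -> z \notin xs2.
  by move=> /n12[/nx12//|zS1]; apply: contra zS1; apply: x2S.
split=> //; first exact: subgraph_trans s23.
- by rewrite !size_cat z12 z23.
- rewrite cat_uniq u12 u23 andbT /=; apply/hasPn => z /n23[z2|zS2].
    by apply/negP => /ys1N; rewrite z2.
  by apply: contra zS2 => /o12[].
- move=> z; rewrite mem_cat => /orP[z1|/o23//]; have [zS2 dz] := o12 _ z1.
  by split; [apply: S23 | apply: leq_trans (d23 _ zS2 (ys1N _ z1)) dz].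
- move=> z; rewrite !mem_cat => /orP[/n12|/n23] [->|zS]; rewrite ?orbT; [by left|by right|by left|].
  by right; apply: contra zS; apply: S12.
- move=> v Sv; rewrite mem_cat negb_or => /andP[v1 v2].
  by apply: leq_trans (d12 v Sv v1); apply: d23 => //; apply: S12.
- by rewrite c23 c12 size_cat mulnDl addnA.
Qed.

Lemma region_par S1 S2 S3 xs1 xs2 : subgraph S1 S2 -> subgraph S2 S3 ->
  uniq (xs1 ++ xs2) -> {subset xs1 ++ xs2 <= verts S1} ->
  region S1 S3 (xs1 ++ xs2) = region S1 S2 xs1 :|: region S2 S3 xs2 /\
  [disjoint region S1 S2 xs1 & region S2 S3 xs2].
Proof.
move=> s12 s23 Ux xS; have S12 := subsetP s12.1; have S23 := subsetP s23.1.
have xS2 z : z \in xs1 ++ xs2 -> z \in verts S2 by move/xS/S12.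
split.
  apply/setP => z; rewrite !inE !mem_cat.
  have [zS1|zS1] := boolP (z \in verts S1); first by rewrite (S12 _ zS1).
  have [zS2|zS2] := boolP (z \in verts S2); first by rewrite (S23 _ zS2).
  by rewrite /= [RHS]orbCA orbA.
rewrite -setI_eq0; apply/eqP/setP => z; rewrite in_set0 !inE.
apply/negP => /andP[/orP[/andP[zS1 zS2]|z1] /orP[/andP[zS2' _]|z2]].
- by rewrite zS2 in zS2'.
- by rewrite xS ?mem_cat ?z2 ?orbT in zS1.
- by rewrite xS2 ?mem_cat ?z1 in zS2'.
- move: Ux; rewrite cat_uniq => /and3P[_ /hasP[]]; by exists z.
Qed.

End Stages.

Section Switch.
Variables (T : finType) (G : graph T) (D m h : nat).
Implicit Types (S : graph T) (U W : {set T}) (q : seq T).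
Hypothesis jG : joined m G.
Hypothesis D5 : 5 <= D.
Hypothesis m0 : 0 < m.
Hypothesis h0 : 0 < h.
Hypothesis mh : m <= 2 ^ h.

Local Notation ext := (nat_extendable G D m).
Local Notation roomy := (roomy G D m h).
Local Notation stage := (stage G D m).

(** Both paths have length [X + 1 + X] with [X = h * w.+1 + w] and
    [w = 2 * h + 1]: this is plain for the path from [a] to [d], which consists of
    two paths of length [X] and an edge, and [X] is chosen such that the three
    other routes have this length too. *)
Definition switch_length := 2 * (h * (2 * h).+2 + (2 * h).+1) + 1.

(** The cycle is an edge [p1 q1] closed by a path of length [4 * h + 3], which is
    long enough to be supplied by [bridge] and gives [4 * h + 4] vertices, a
    multiple of four, so that [ladder] can consume them in rounds. *)
Lemma switch_gadget S a b : ext S -> roomy S (2 * switch_length) -> a != b ->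
  a \in verts S -> b \in verts S -> degree S a <= 1 -> degree S b <= 1 ->
  exists S' c d, [/\ stage S S' [:: a; b] [:: c; d] switch_length,
    linked S' (region S S' [:: a; b]) (legs switch_length [:: a; b] [:: c; d]) &
    linked S' (region S S' [:: a; b]) (legs switch_length [:: a; b] [:: d; c])].
Proof.
move=> eS rS nab Sa Sb da db.
pose w := (2 * h).+1; pose X := h * w.+1 + w.
have Lw : switch_length = 2 * X + 1 by [].
have X0 : 0 < X by rewrite addn_gt0 orbT.
have [||qa [S1 [a1 z1 pt1 d1 D1]]] := attach (h := h) jG D5 m0 (l := X) eS _ Sa.
- by apply: roomy_le rS; rewrite Lw; clear; lia.
- by move: da D5; clear; lia.
set p1 := last a qa in d1.
have p1q : p1 \in qa by rewrite /p1; case: (qa) z1 X0 => [<-//|z q _ _ /=]; apply: mem_last.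
have S1p1 : p1 \in verts S1 by rewrite (adds_verts a1) !inE p1q orbT.
have [||qs [S2 [a2 z2 pt2 d2 D2]]] := attach (h := h) jG D5 m0 (l := 1) (adds_ext a1) _ S1p1.
- by apply: roomy_le rS; rewrite (adds_card a1) z1 Lw; clear; lia.
- by have := d1 X0; move: D5; clear; lia.
case: qs z2 a2 pt2 d2 => [//|q1 [|//]] z2 a2 /= /andP[apq _] /(_ isT) d2.
have q1S1 : q1 \notin verts S1 by apply: (adds_new a2); rewrite mem_head.
have S2p1 := subsetP (adds_sub a2).1 _ S1p1.
have S2q1 : q1 \in verts S2 by rewrite (adds_verts a2) !inE eqxx orbT.
have nqp : q1 != p1 by apply: contraNneq q1S1 => ->.
have dp1 : degree S2 p1 <= 2 by have := D2 _ S1p1; have := d1 X0; rewrite eqxx; clear; lia.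
have [||||r [S3 [a3 z3 pt3 D3]]] :=
  bridge jG D5 m0 h0 mh (l := 4 * h + 3) (adds_ext a2) _ S2q1 S2p1 nqp.
- apply: roomy_le rS; rewrite (adds_card a2) (adds_card a1) z1 /= Lw /X /w.
  by move: h0; clear; nia.
- by move: d2 D5; clear; lia.
- by move: dp1 D5; clear; lia.
- by clear; lia.
case: r z3 a3 pt3 => [|p2 [|q2 rest]] z3 a3 pt3.
- by move: z3; rewrite /=; clear; lia.
- by move: z3; rewrite /=; clear; lia.
have zrest : size rest = 4 * h by move: z3; rewrite /=; clear; lia.
have S12 := subsetP (adds_sub a1).1; have S23 := subsetP (adds_sub a2).1.
have S34 := subsetP (adds_sub a3).1.
have V1 := adds_verts a1; have V2 := adds_verts a2; have V3 := adds_verts a3.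
have S3b : b \in verts S3 by apply/S34/S23/S12.
have S3p2 : p2 \in verts S3 by rewrite V3 !inE eqxx orbT.
have p2S2 : p2 \notin verts S2 by apply: (adds_new a3); rewrite mem_head.
have nbp2 : b != p2 by apply: contraNneq p2S2 => <-; apply/S23/S12.
have dp2 : degree S3 p2 <= 2 by apply: (adds_degree a3); rewrite mem_head.
have bnp1 : (b == p1) = false.
  by apply: contraTF Sb => /eqP->; apply: adds_new a1 _ p1q.
have bnq1 : (b == q1) = false by apply: contraNF q1S1 => /eqP<-; apply: S12.
have d3b : degree S3 b <= 1.
  have := D3 _ (S23 _ (S12 _ Sb)); have := D2 _ (S12 _ Sb); have := D1 _ Sb.
  by rewrite [b == a]eq_sym (negPf nab) bnp1 bnq1; move: db; clear; lia.
have [||||s [S4 [a4 z4 pt4 D4]]] := bridge jG D5 m0 h0 mh (l := w) (adds_ext a3) _ S3b S3p2 nbp2.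
- apply: roomy_le rS; rewrite (adds_card a3) (adds_card a2) (adds_card a1) z1 /= Lw zrest /X /w.
  by move: h0; clear; nia.
- by move: d3b D5; clear; lia.
- by move: dp2 D5; clear; lia.
- by [].
have V4 := adds_verts a4; have S45 := subsetP (adds_sub a4).1.
have sub14 : subgraph S1 S4.
  exact: subgraph_trans (adds_sub a2) (subgraph_trans (adds_sub a3) (adds_sub a4)).
have sub04 := subgraph_trans (adds_sub a1) sub14.
have sub24 := subgraph_trans (adds_sub a3) (adds_sub a4).
have newa z : z \in qa -> z \notin verts S by apply: adds_new a1 _.
have newr z : z \in [:: p2, q2 & rest] -> z \notin verts S2 by apply: adds_new a3 _.
have news z : z \in s -> z \notin verts S3 by apply: adds_new a4 _.
pose W := [set z in a :: qa] :|: [set z in b :: rcons s p2].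
have Ua : uniq (a :: qa).
  by rewrite /= (adds_uniq a1) andbT; apply/negP => /newa; rewrite Sa.
have Ub : uniq (b :: rcons s p2).
  rewrite /= mem_rcons inE (negPf nbp2) rcons_uniq (adds_uniq a4) andbT /=.
  by apply/andP; split; apply/negP => /news; rewrite ?S3b ?S3p2.
have inb z : z \in b :: rcons s p2 = [|| z == b, z == p2 | z \in s] by rewrite inE mem_rcons inE.
have lk : linked S4 W [:: (a, p1, X); (b, p2, w)].
  have l1 : linked S4 [set z in a :: qa] [:: (a, p1, X)].
    rewrite -z1; apply: linked1 => //; apply: sub_path pt1 => i j; exact: sub14.2.
  have l2 : linked S4 [set z in b :: rcons s p2] [:: (b, p2, w)].
    by rewrite -z4 -(size_rcons s p2) -{2}(last_rcons b s p2); apply: linked1.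
  apply: linked_cat l1 l2; rewrite disjoints_subset; apply/subsetP => z.
  rewrite !in_setC !in_set inb inE => /predU1P[->|za].
    rewrite (negPf nab) /= negb_or; apply/andP; split.
      by apply: contraNneq p2S2 => <-; apply/S23/S12.
    by apply/negP => /news/negP[]; apply/S34/S23/S12.
  have S1z : z \in verts S1 by rewrite V1 !inE za orbT.
  rewrite !negb_or; apply/and3P; split.
  - by apply: contraNneq (newa _ za) => ->.
  - by apply: contraNneq p2S2 => <-; apply: S23.
  - by apply/negP => /news/negP[]; apply/S34/S23.
have inW z : z \in W = (z \in a :: qa) || (z \in b :: rcons s p2) by rewrite !in_set.
have V4E z : z \in verts S4 =
    [|| z \in verts S, z \in qa, z == q1, z \in [:: p2, q2 & rest] | z \in s].
  by rewrite V4 V3 V2 V1 !in_setU !in_set mem_seq1 -!orbA.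
have mid z : z \in [:: q2 & rest] -> z \in [:: p2, q2 & rest].
  by move=> zr; rewrite inE zr orbT.
have Ur : uniq [:: p2, q2 & rest] := adds_uniq a3.
have midn z : z \in [:: q2 & rest] -> z != p2.
  by move=> zr; apply: contraTneq zr => ->; case/andP: Ur.
have D4' v : v \in verts S3 -> v != b -> v != p2 -> degree S4 v <= degree S3 v.
  by move=> Sv /negPf vb /negPf vp; have := D4 v Sv; rewrite vb vp !addn0.
have S3p1 := S34 _ S2p1; have S3q1 := S34 _ S2q1.
have q1p2 : q1 != p2 by apply: contraNneq p2S2 => <-.
have := @ladder T G D m h jG D5 m0 h0 mh h S4 p1 q1 p2 q2 rest W X w w X X a b p1.
rewrite /= -/w; case=> //.
- exact: adds_ext a4.
- apply: roomy_le rS; rewrite (adds_card a4) (adds_card a3) (adds_card a2) (adds_card a1).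
  have zs : size s = 2 * h by case: z4.
  by rewrite z1 zs /= zrest Lw /X /w; clear; nia.
- have nS2 z : z \in verts S2 -> z \notin [:: p2, q2 & rest].
    by move=> Sz; apply/negP => /newr; rewrite Sz.
  rewrite in_cons negb_or eq_sym nqp (nS2 _ S2p1) (nS2 _ S2q1) /=.
  by move: Ur; rewrite /= => ->.
- move=> z; rewrite in_cons => /predU1P[->|]; first exact: S45.
  rewrite in_cons => /predU1P[->|zr]; first exact: S45.
  by rewrite V4E zr ?orbT.
- move: pt3; rewrite /= rcons_path => /and4P[e1 e2 e3 e4].
  rewrite (sub24.2 _ _ apq) !(adds_sub a4).2 //=.
  by apply: sub_path e3 => i j; apply: (adds_sub a4).2.
- move: pt3; rewrite /= rcons_path => /and4P[_ _ _ e4].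
  by rewrite adj_sym; apply: (adds_sub a4).2.
- move=> z; rewrite in_cons => /predU1P[->|zr].
    apply: leq_trans (D4' _ S3q1 _ q1p2) _; first by rewrite eq_sym bnq1.
    have := D3 _ S2q1; rewrite eqxx (negPf nqp); move: d2; clear; lia.
  have S3z : z \in verts S3 by rewrite V3 in_setU in_set mid ?orbT.
  apply: leq_trans (D4' _ S3z _ (midn _ zr)) _; last exact: (adds_degree a3) (mid _ zr).
  by apply: contraNneq (newr _ (mid _ zr)) => ->; apply/S23/S12.
- apply/subsetP => z; rewrite inW inb inE.
  case/or3P => [/predU1P[->|za]|/eqP->|/orP[/eqP->|zs]].
  + exact: (subsetP sub04.1).
  + by rewrite V4E za ?orbT.
  + exact: S45.
  + exact: S45.
  + by rewrite V4E zs ?orbT.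
- by rewrite inW inE p1q ?orbT.
- by rewrite inW inb eqxx ?orbT.
- move=> z zr; rewrite inW inb inE !negb_or -!andbA.
  have zS : (z \in verts S3) && (z \notin verts S1) && (z != p2).
    move: zr; rewrite in_cons => /predU1P[->|zr]; first by rewrite S3q1 q1S1.
    rewrite midn // andbT V3 in_setU in_set mid // orbT /=.
    by apply: contra (newr _ (mid _ zr)); apply: S23.
  case/andP: zS => /andP[zS3 zS1] ->.
  have nz v : v \in verts S1 -> z != v by move=> Sv; apply: contraNneq zS1 => ->.
  rewrite !nz ?S12 //= (_ : z \notin s) ?andbT; last by apply/negP => /news; rewrite zS3.
  by apply: contra zS1; rewrite V1 in_setU in_set => ->; rewrite orbT.
move=> S' [c [d [[eS' sS' cS' dS'] [[cN dN ncd dc dd] [lc ld]]]]].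
have S56 := subsetP sS'.1.
have cz : size s = 2 * h by case: z4.
have R_eq : W :|: [set z in [:: p1, q1, p2, q2 & rest]] :|: (verts S' :\: verts S4) =
    region S S' [:: a; b].
  apply/setP => z; rewrite /region !in_setU !in_setD !in_set inb V4E !inE.
  have V4S := S56 z; rewrite V4E !inE in V4S.
  have [Sz|Sz] := boolP (z \in verts S).
    have -> : (z \in qa) = false by apply/negP => /newa; rewrite Sz.
    have -> : (z \in s) = false by apply/negP => /news; rewrite (S34 _ (S23 _ (S12 _ Sz))).
    have -> : (z == p1) = false by apply: contraTF Sz => /eqP->; apply: newa.
    have -> : (z == q1) = false by apply: contraTF Sz => /eqP->; apply: contra q1S1; apply: S12.
    have zr : z \notin [:: p2, q2 & rest].
      by apply: contraL Sz => /newr; apply: contra => zS; apply/S23/S12.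
    move: zr; rewrite !inE !negb_or => /and3P[/negPf-> /negPf-> /negPf->].
    by rewrite /= !orbF.
  have -> : (z == p1) = (z == p1) && (z \in qa) by case: eqP => // ->; rewrite p1q.
  rewrite (negPf Sz) /= in V4S *; move: V4S.
  pose n := [|| z \in qa, z == q1, [|| z == p2, z == q2 | z \in rest] | z \in s].
  rewrite -/n; have [nz /(_ isT)->|nz _] := boolP n; last first.
    move: nz; rewrite /n !negb_or => /and4P[/negPf-> /negPf-> /and3P[/negPf-> /negPf-> /negPf->]].
    move=> /negPf->.
    by rewrite andbF !orbF /= orbC.
  move: nz; rewrite /n; case: (z \in qa); first by rewrite /= ?orbT.
  case: (z == q1); first by rewrite /= ?orbT.
  case: (z == p2); first by rewrite /= ?orbT.
  case: (z == q2); first by rewrite /= ?orbT.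
  case: (z \in rest); first by rewrite /= ?orbT.
  by case: (z \in s); rewrite /= ?orbT.
have outN z : z \in verts S' :\: verts S4 -> z \in verts S' /\ z \notin verts S.
  by rewrite !inE => /andP[zS4 ->]; split=> //; apply: contra zS4; apply: (subsetP sub04.1).
exists S', c, d; split.
- split=> //.
  + exact: subgraph_trans sub04 sS'.
  + by rewrite /= inE ncd.
  + by move=> z; rewrite !inE => /orP[]/eqP->; split=> //; case/outN: (cN) (dN) => ? _ /outN[].
  + by move=> z; rewrite !inE => /orP[]/eqP->; right; case/outN: (cN) (dN) => _ ? /outN[].
  + move=> v Sv; rewrite !inE negb_or => /andP[va vb].
    have S1v := S12 _ Sv; have S2v := S23 _ S1v; have S3v := S34 _ S2v.
    have vn z : z \notin verts S -> (v == z) = false by move=> Sz; apply: contraNF Sz => /eqP<-.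
    have vp2 : (v == p2) = false by apply: contraNF p2S2 => /eqP<-.
    have vp1 : (v == p1) = false by apply: vn; apply: newa.
    have vq1 : (v == q1) = false by apply: contraNF q1S1 => /eqP<-.
    apply: leq_trans (dS' v (S45 _ S3v) _) _.
      rewrite in_cons vq1 /=; apply: contraL S2v => vr; apply: newr.
      by apply: mid.
    apply: leq_trans (D4' v S3v vb (negbT vp2)) _.
    have := D3 v S2v; have := D2 v S1v; have := D1 v Sv.
    by rewrite vp1 vq1 (negPf va) !addn0 => h1 h2 h3; apply: leq_trans h3 (leq_trans h2 h1).
  + rewrite cS' (adds_card a4) (adds_card a3) (adds_card a2) (adds_card a1) z1 /= zrest cz.
    by rewrite Lw /X /w; clear; nia.
- have eL : X + h * w.+1 + 1 + w = switch_length by rewrite Lw /X; clear; lia.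
  have eL' : w + h * w.+1 + 1 + X = switch_length by rewrite Lw /X; clear; lia.
  by move: lc; rewrite R_eq eL eL'.
- have eL : X + 1 + X = switch_length by rewrite Lw; clear; lia.
  have eL' : w + 2 * (h * w.+1) + 1 + w = switch_length by rewrite Lw /X; clear; lia.
  by move: ld; rewrite R_eq eL eL'.
Qed.

End Switch.

(** * Splitting a permutation of paired wires *)

Section Colouring.

(** Let [r = s \o t].  Both [s] and [t] carry the [r]-orbit of [x] to that of
    [s x].  These orbits differ, for if [s x = iter k r x], then going half way
    yields a fixed point of [s] or [t].  So orbits come in pairs, and ranking them
    by their roots colours the two orbits of a pair differently. *)
Lemma two_colouring_free (T : finType) (s t : T -> T) :
  involutive s -> involutive t -> (forall x, s x != x) -> (forall x, t x != x) ->
  exists c : T -> bool, forall x, c (s x) = ~~ c x /\ c (t x) = ~~ c x.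
Proof.
move=> sK tK sN tN; pose r x := s (t x).
have r_inj : injective r by apply: inj_comp; apply: inv_inj.
have rN k x : iter k r x != s x.
  elim/ltn_ind: k x => [[|[|k]]] IH x; first by rewrite eq_sym.
    by rewrite /= /r (inj_eq (inv_inj sK)).
  rewrite iterS iterSr /r (inj_eq (inv_inj sK)) -/(r x).
  have := IH k (leqnSn _) (r x); rewrite [s (r x)]sK.
  by apply: contraNneq => e; rewrite -(inj_eq (inv_inj tK)) tK e.
have root_s x : froot r x != froot r (s x).
  rewrite (root_connect (fconnect_sym r_inj)); apply/negP => xs.
  by have := rN (findex r x (s x)) x; rewrite iter_findex ?eqxx.
have root_t x : froot r (t x) = froot r (s x).
  apply/eqP; rewrite (root_connect (fconnect_sym r_inj)).
  by have := fconnect1 r (t x); rewrite /r tK.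
pose rk x : nat := index x (enum T).
have rk_inj : injective rk.
  by move=> x y e; rewrite -(nth_index x (mem_enum T x)) -/(rk x) e nth_index ?mem_enum.
pose c x := rk (froot r x) < rk (froot r (s x)).
have cN x y : x != y -> (rk x < rk y) = ~~ (rk y < rk x).
  move=> nxy; rewrite -leqNgt [RHS]leq_eqVlt; case: eqP => // e.
  by rewrite (rk_inj _ _ e) eqxx in nxy.
exists c => x; rewrite /c; split; first by rewrite sK cN // eq_sym.
rewrite root_t (_ : froot r (s (t x)) = froot r x) 1?cN 1?eq_sym //.
apply/esym/eqP; rewrite (root_connect (fconnect_sym r_inj)); exact: (fconnect1 r x).
Qed.

(** A graph that is a union of two matchings is bipartite.  Taking two copies
    of the vertices, with the copies of an unmatched vertex matched together,
    reduces to perfect matchings. *)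
Lemma two_colouring (T : finType) (s t : T -> T) : involutive s -> involutive t ->
  exists c : T -> bool, forall x,
    (s x != x -> c (s x) = ~~ c x) /\ (t x != x -> c (t x) = ~~ c x).
Proof.
move=> sK tK.
pose dbl (f : T -> T) (xb : T * bool) := (f xb.1, (f xb.1 == xb.1) (+) xb.2).
have dblK f : involutive f -> involutive (dbl f).
  by move=> fK [x b]; rewrite /dbl /= fK eq_sym addbA addbb.
have dblN f : involutive f -> forall xb, dbl f xb != xb.
  move=> fK [x b]; rewrite /dbl /= xpair_eqE /=.
  by case: eqP => //= _; case: b.
have [c cP] := two_colouring_free (dblK _ sK) (dblK _ tK) (dblN _ sK) (dblN _ tK).
exists (fun x => c (x, true)) => x.
have [] := cP (x, true); rewrite /dbl /= => cs ct.
by split=> /negPf n; [move: cs | move: ct]; rewrite n.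
Qed.

End Colouring.

Lemma seq_ind2step (A : Type) (P : seq A -> Prop) : P [::] -> (forall x, P [:: x]) ->
  (forall x y s, P s -> P [:: x, y & s]) -> forall s, P s.
Proof.
move=> P0 P1 P2 s; elim: {s}(size s).+1 {-2}s (ltnSn (size s)) => // n IH.
by case=> [|x [|y s]] //= sn; apply: P2; apply: IH; apply: ltnW.
Qed.

Fixpoint swaps (A : Type) (bs : seq bool) (s : seq A) : seq A :=
  match s with
  | [:: x, y & s'] =>
      (if head false bs then [:: y; x] else [:: x; y]) ++ swaps (behead bs) s'
  | _ => s
  end.

Fixpoint evens (A : Type) (s : seq A) : seq A :=
  if s is [:: x, _ & s'] then x :: evens s' else s.

Fixpoint odds (A : Type) (s : seq A) : seq A :=
  if s is [:: _, y & s'] then y :: odds s' else [::].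

Fixpoint interleave (A : Type) (s t : seq A) : seq A :=
  match s, t with
  | x :: s', y :: t' => [:: x, y & interleave s' t']
  | _, _ => s ++ t
  end.

Lemma swapsK (A : Type) bs : involutive (@swaps A bs).
Proof.
move=> s; elim/seq_ind2step: s bs => //= x y s IH bs.
by case E: (head false bs) => /=; rewrite E IH.
Qed.

Lemma size_swaps (A : Type) bs (s : seq A) : size (swaps bs s) = size s.
Proof.
elim/seq_ind2step: s bs => //= x y s IH bs.
by rewrite size_cat IH; case: (head false bs).
Qed.

Lemma zip_swaps (A B : Type) bs (s : seq A) (t : seq B) : size s = size t ->
  zip (swaps bs s) (swaps bs t) = swaps bs (zip s t).
Proof.
elim/seq_ind2step: s bs t => [|x|x y s IH] bs [|u [|v t]] //= [] st.
by case: (head false bs) => /=; rewrite IH.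
Qed.

Lemma perm_swaps (A : eqType) bs (s : seq A) : perm_eq (swaps bs s) s.
Proof.
elim/seq_ind2step: s bs => //= x y s IH bs.
case: (head false bs) => /=; rewrite ?perm_cons // (perm_catCA [:: y] [:: x]).
by rewrite /= !perm_cons.
Qed.

Lemma perm_evens_odds (A : eqType) (s : seq A) : perm_eq (evens s ++ odds s) s.
Proof.
elim/seq_ind2step: s => //= x y s IH.
by rewrite perm_cons (perm_catCA (evens s) [:: y]) perm_cons.
Qed.

Lemma size_evens (A : Type) (s : seq A) : size (evens s) = uphalf (size s).
Proof. by elim/seq_ind2step: s => //= x y s ->. Qed.

Lemma size_odds (A : Type) (s : seq A) : size (odds s) = (size s)./2.
Proof. by elim/seq_ind2step: s => //= x y s ->. Qed.

Lemma zip_evens (A B : Type) (s : seq A) (t : seq B) : size s = size t ->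
  zip (evens s) (evens t) = evens (zip s t).
Proof.
by elim/seq_ind2step: s t => [|x|x y s IH] [|u [|v t]] //= [] st; rewrite IH.
Qed.

Lemma zip_odds (A B : Type) (s : seq A) (t : seq B) : size s = size t ->
  zip (odds s) (odds t) = odds (zip s t).
Proof.
by elim/seq_ind2step: s t => [|x|x y s IH] [|u [|v t]] //= [] st; rewrite IH.
Qed.

Lemma zip_split_perm (A B : eqType) (s : seq A) (t : seq B) : size s = size t ->
  perm_eq (zip (evens s ++ odds s) (evens t ++ odds t)) (zip s t).
Proof.
move=> st; rewrite zip_cat ?size_evens ?st // zip_evens // zip_odds //.
exact: perm_evens_odds.
Qed.

Lemma interleaveK (A : Type) (s t : seq A) : size t <= size s <= (size t).+1 ->
  evens (interleave s t) = s /\ odds (interleave s t) = t.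
Proof.
elim: s t => [|x s IH] [|y t] //=; first by case: s {IH}.
by rewrite !ltnS => /IH[-> ->].
Qed.

Section Splitting.
Variable T : finType.
Implicit Types (s t : seq T) (c : T -> bool).

(** The vertex sharing a switch with [z] when the wires of [s] are paired from
    the left; the last wire of a list of odd length is its own partner. *)
Fixpoint partner s z : T :=
  if s is [:: x, y & s'] then
    if z == x then y else if z == y then x else partner s' z
  else z.

Lemma partner_notin s z : z \notin s -> partner s z = z.
Proof.
elim/seq_ind2step: s => //= x y s IH.
by rewrite !inE !negb_or => /and3P[/negPf-> /negPf-> /IH].
Qed.

Lemma partner_mem s z : z \in s -> partner s z \in s.
Proof.
elim/seq_ind2step: s => //= x y s IH; rewrite !inE.
case: (z =P x) => [_ _|_]; first by rewrite eqxx orbT.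
case: (z =P y) => [_ _|_ /= /IH->]; first by rewrite eqxx.
by rewrite !orbT.
Qed.

Lemma partnerK s : uniq s -> involutive (partner s).
Proof.
elim/seq_ind2step: s => // x y s IH Us z.
have [nxy [xs [ys Us']]] : x != y /\ x \notin s /\ y \notin s /\ uniq s.
  by move: Us; rewrite /= inE negb_or => /andP[/andP[-> ->] /andP[-> ->]].
have [zs|zs] := boolP (z \in s).
  have nz u v : u \notin s -> v \in s -> (v == u) = false.
    by move=> us vs; apply: contraNF us => /eqP<-.
  by rewrite /= !(nz _ z) // !(nz _ (partner s z)) ?partner_mem ?IH.
rewrite /=; case: (z =P x) => [->|zx]; first by rewrite eq_sym (negPf nxy) eqxx.
case: (z =P y) => [->|zy]; first by rewrite eqxx.
by rewrite partner_notin //; case: eqP => // _; case: eqP => // _; rewrite partner_notin.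
Qed.

Fixpoint alternating c s :=
  if s is [:: x, y & s'] then (c x != c y) && alternating c s' else true.

Lemma partner_alternating c s : uniq s ->
  (forall x, partner s x != x -> c (partner s x) = ~~ c x) -> alternating c s.
Proof.
elim/seq_ind2step: s => // x y s IH Us cP.
have [nxy [xs [ys Us']]] : x != y /\ x \notin s /\ y \notin s /\ uniq s.
  by move: Us; rewrite /= inE negb_or => /andP[/andP[-> ->] /andP[-> ->]].
rewrite /= IH // ?andbT.
  by have := cP x; rewrite /= eqxx eq_sym => /(_ nxy) ->; case: (c x).
move=> z; have := cP z; rewrite /=.
have [zs|zs] := boolP (z \in s); last by rewrite partner_notin ?eqxx.
have -> : (z == x) = false by apply: contraNF xs => /eqP<-.
by have -> : (z == y) = false by apply: contraNF ys => /eqP<-.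
Qed.

(** A pair contributes one to either count, and an unpaired entry one to only
    one of them. *)
Lemma alternating_count c s : alternating c s ->
  count c s = (size s)./2 \/ count (predC c) s = (size s)./2.
Proof.
elim/seq_ind2step: s => [|x|x y s IH] /=; first by left.
  by case: (c x); [right | left].
move=> /andP[cxy /IH[] e]; [left|right]; move: e cxy.
  by case: (c x); case: (c y) => //= ->.
by case: (c x); case: (c y) => //= ->.
Qed.

Lemma alternatingC c s : alternating c s -> alternating (fun x => ~~ c x) s.
Proof.
elim/seq_ind2step: s => //= x y s IH /andP[cxy /IH->]; rewrite andbT.
by move: cxy; case: (c x); case: (c y).
Qed.

Lemma alternating_split c s : alternating c s -> count c s = (size s)./2 ->
  exists bs, evens (swaps bs s) = filter (predC c) s /\
             odds (swaps bs s) = filter c s.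
Proof.
elim/seq_ind2step: s => [|x|x y s IH] /=; first by exists [::].
  by case: (c x) => // _ _; exists [::].
move=> /andP[cxy /IH{}IH] cs.
have [|bs [e o]] := IH; first by move: cs cxy; case: (c x); case: (c y) => //= -[].
exists (c x :: bs); move: cxy; rewrite /=; case: (c x); case: (c y) => //= _.
  by rewrite e o.
by rewrite e o.
Qed.

(** One step of the looping algorithm for Benes networks.  Colour the wires so
    that wires sharing a switch get different colours, both on the side of
    [zs] and on the side of [ys]; the two colour classes are the two halves of
    the network.  When the number of wires is odd, counting shows that the
    unpaired wires of both sides may be given the same colour. *)
Lemma benes_split (zs ys : seq T) : uniq ys -> perm_eq zs ys -> exists bs1 bs2,
  perm_eq (evens (swaps bs1 zs)) (evens (swaps bs2 ys)) /\
  perm_eq (odds (swaps bs1 zs)) (odds (swaps bs2 ys)).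
Proof.
move=> Uy pzy; have Uz : uniq zs by rewrite (perm_uniq pzy).
have [c cP] := two_colouring (partnerK Uy) (partnerK Uz).
have ay : alternating c ys by apply: partner_alternating => // x; case: (cP x).
have az : alternating c zs by apply: partner_alternating => // x; case: (cP x).
have [d [dy dz dc]] : exists d, [/\ alternating d ys, alternating d zs &
    count d ys = (size ys)./2].
  have [cy|cy] := alternating_count ay; first by exists c.
  by exists (fun x => ~~ c x); split=> //; apply: alternatingC.
have [|bs1 [e1 o1]] := alternating_split dz.
  by rewrite (permP pzy) (perm_size pzy).
have [bs2 [e2 o2]] := alternating_split dy dc.
by exists bs1, bs2; rewrite e1 e2 o1 o2; split; apply: perm_filter.
Qed.

Lemma perm_map_lift (A B : eqType) (f : A -> B) (s : seq A) (t : seq B) :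
  perm_eq (map f s) t -> exists2 s', perm_eq s s' & map f s' = t.
Proof.
elim: t s => [|y t IH] s pst.
  by exists [::] => //; case: s pst => // x s /perm_size.
have /mapP[x xs ey] : y \in map f s by rewrite (perm_mem pst) mem_head.
have pr := perm_to_rem xs.
have [|s' ps' es'] := IH (rem x s).
  have := perm_map f pr; rewrite perm_sym => /perm_trans/(_ pst).
  by rewrite /= -ey perm_cons.
exists (x :: s'); last by rewrite /= es' ey.
by rewrite (permPl pr) perm_cons.
Qed.

(** A bijection, given as a [zip], with its targets listed in another order. *)
Lemma perm_realign (A B : eqType) (v : seq A) (s t : seq B) :
  size v = size s -> perm_eq s t ->
  exists v', [/\ size v' = size t, perm_eq v' v & perm_eq (zip v s) (zip v' t)].
Proof.
move=> vs st; have : perm_eq (unzip2 (zip v s)) t by rewrite unzip2_zip ?vs.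
case/perm_map_lift => ps pps eps; exists (unzip1 ps); split.
- by rewrite -eps !size_map.
- by rewrite -(unzip1_zip (eq_leq vs)); apply: perm_map; rewrite perm_sym.
- by rewrite -eps zip_unzip.
Qed.

End Splitting.

(** * The Benes network *)

Section LegsStages.
Variable T : finType.
Implicit Types (S : graph T) (W : {set T}) (xs ys zs : seq T).

Lemma legs_cat l xs1 xs2 ys1 ys2 : size xs1 = size ys1 ->
  legs l (xs1 ++ xs2) (ys1 ++ ys2) = legs l xs1 ys1 ++ legs l xs2 ys2.
Proof. by move=> s1; rewrite /legs zip_cat // map_cat. Qed.

Lemma legs_perm l xs ys xs' ys' : perm_eq (zip xs ys) (zip xs' ys') ->
  perm_eq (legs l xs ys) (legs l xs' ys').
Proof. exact: perm_map. Qed.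

Lemma region_eq S S' xs xs' : xs =i xs' -> region S S' xs = region S S' xs'.
Proof. by move=> e; apply/setP => z; rewrite !inE e. Qed.

Lemma stage_perm (G : graph T) D m S S' xs xs' ys ys' l :
  perm_eq xs xs' -> perm_eq ys ys' ->
  stage G D m S S' xs ys l -> stage G D m S S' xs' ys' l.
Proof.
move=> px py [e s z u o n d c]; split=> //.
- by rewrite -(perm_size px) -(perm_size py).
- by rewrite -(perm_uniq py).
- by move=> y; rewrite -(perm_mem py); apply: o.
- by move=> y; rewrite -(perm_mem py) -(perm_mem px); apply: n.
- by move=> v Sv; rewrite -(perm_mem px); apply: d.
- by rewrite -(perm_size px).
Qed.

End LegsStages.

Section Network.
Variables (T : finType) (G : graph T) (D m h : nat).
Implicit Types (S : graph T) (U W : {set T}) (xs ys : seq T).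
Hypothesis jG : joined m G.
Hypothesis D5 : 5 <= D.
Hypothesis m0 : 0 < m.
Hypothesis h0 : 0 < h.
Hypothesis mh : m <= 2 ^ h.

Local Notation ext := (nat_extendable G D m).
Local Notation roomy := (roomy G D m h).
Local Notation stage := (stage G D m).
Local Notation L := (switch_length h).

Definition inputs S xs := uniq xs /\ {in xs, forall x, x \in verts S /\ degree S x <= 1}.

Lemma inputs_sub S S' xs xs0 l ys : inputs S (xs0 ++ xs) -> stage S S' xs0 ys l ->
  inputs S' xs.
Proof.
move=> [U xS] st; move: U; rewrite cat_uniq => /and3P[_ n Ux]; split=> // x xx.
have [|Sx dx] := xS x; first by rewrite mem_cat xx orbT.
split; first by apply: (subsetP (stage_sub st).1).
apply: leq_trans dx; apply: (stage_old st) => //.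
by apply: contra n => x0; apply/hasP; exists x.
Qed.

Lemma stage_inputs S S' xs ys l : stage S S' xs ys l -> inputs S' ys.
Proof. by move=> st; split; [apply: stage_uniq st | apply: stage_out st]. Qed.

Lemma inputs_perm S xs ys : perm_eq xs ys -> inputs S xs -> inputs S ys.
Proof.
by move=> p [U xS]; split; [rewrite -(perm_uniq p) | move=> x; rewrite -(perm_mem p); apply: xS].
Qed.

Lemma switch_layer xs S : ext S -> inputs S xs -> roomy S (size xs * L) ->
  exists S' ys, stage S S' xs ys L /\
    forall bs, linked S' (region S S' xs) (legs L xs (swaps bs ys)).
Proof.
elim/seq_ind2step: xs S => [|x|x y xs IH] S eS [Ux xS] rS.
- exists S, [::]; split; first by split=> //=; rewrite addn0.
  move=> bs; rewrite (_ : region S S [::] = set0); first exact: linked0.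
  by apply/setP => z; rewrite !inE andNb.
- have [Sx dx] := xS x (mem_head _ _).
  have L0 : 0 < L by rewrite /switch_length addn1.
  have [||q [S' [aS z p d dS]]] := attach (h := h) jG D5 m0 (l := L) eS _ Sx.
  + by move: rS; rewrite mul1n.
  + by move: dx D5; clear; lia.
  have lq : last x q \in q by case: (q) z L0 => [<-//|u q' _ _ /=]; apply: mem_last.
  exists S', [:: last x q]; split.
    split=> //.
    + exact: adds_ext aS.
    + exact: adds_sub aS.
    + move=> y; rewrite inE => /eqP->; split; last exact: d.
      by rewrite (adds_verts aS) !inE lq orbT.
    + by move=> y; rewrite inE => /eqP->; right; apply: adds_new aS _ lq.
    + by move=> v Sv; rewrite inE => /negPf vx; have := dS v Sv; rewrite vx addn0.
    + by rewrite (adds_card aS) z mul1n.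
  move=> bs; have Uq : uniq (x :: q).
    by rewrite /= (adds_uniq aS) andbT; apply/negP => /(adds_new aS); rewrite Sx.
  have := linked1 p Uq; rewrite z; congr linked; apply/setP => u.
  rewrite /region (adds_verts aS) !inE; have [Su|Su] := boolP (u \in verts S).
    have -> : u \in q = false by apply/negP => /(adds_new aS); rewrite Su.
    by rewrite orbF.
  by rewrite /= orbC.
- have Uxy : uniq ([:: x; y] ++ xs) := Ux; move: Ux; rewrite /= inE negb_or => /andP[/andP[nxy _] _].
  have [Sx dx] := xS x (mem_head _ _).
  have [Sy dy] : y \in verts S /\ degree S y <= 1 by apply: xS; rewrite !inE eqxx orbT.
  have [|S1 [c [d [st1 lk lk']]]] := switch_gadget jG D5 m0 h0 mh eS _ nxy Sx Sy dx dy.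
    by apply: roomy_le rS; rewrite /= !mulSn mul0n; clear; lia.
  have in1 : inputs S1 xs by apply: (@inputs_sub S S1 xs [:: x; y] L [:: c; d]).
  have [|S2 [ys [st2 lks]]] := IH S1 (stage_ext st1) in1.
    by apply: roomy_le rS; rewrite (stage_card st1) /=; clear; lia.
  have xyS : {subset [:: x; y] ++ xs <= verts S} by move=> z /xS[].
  have [rE dis] := region_par (stage_sub st1) (stage_sub st2) Uxy xyS.
  exists S2, ([:: c; d] ++ ys); split; first exact: (stage_par st1 st2 Uxy xyS).
  move=> bs; rewrite -[x :: y :: xs]/([:: x; y] ++ xs) rE.
  rewrite (_ : legs _ _ _ = legs L [:: x; y] (if head false bs then [:: d; c] else [:: c; d])
      ++ legs L xs (swaps (behead bs) ys)); last by rewrite /=; case: (head false bs).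
  apply: linked_cat => //; apply: linked_sub (stage_sub st2) _.
  by case: (head false bs).
Qed.

(** Switch the pairs of wires, send the first wire of every pair through one
    network and the second through another, each for half the wires, then
    switch pairs again.  By [benes_split] the two layers of switches can be set so
    that each half has to realise a permutation of its own wires. *)
Lemma benes_network k xs S : size xs <= 2 ^ k -> ext S -> inputs S xs ->
  roomy S (size xs * (2 * k * L)) ->
  exists S' ys, stage S S' xs ys (2 * k * L) /\
    forall zs, perm_eq zs ys -> linked S' (region S S' xs) (legs (2 * k * L) xs zs).
Proof.
elim: k xs S => [|k IH] xs S sxs eS [Ux xS] rS.
  exists S, xs; rewrite muln0 mul0n; split; first exact: stage_refl.
  move=> zs; case: xs sxs {Ux xS rS} => [|x [|//]] _.
    move=> /perm_size/eqP; rewrite size_eq0 => /eqP->.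
    rewrite (_ : region S S [::] = set0); first exact: linked0.
    by apply/setP => z; rewrite !inE andNb.
  move=> /perm_small_eq -> //; have := @linked1 T S x [::] isT isT.
  by congr linked; apply/setP => z; rewrite !inE andNb.
set l := 2 * k * L; have el : 2 * k.+1 * L = L + l + L.
  by rewrite /l; move: L; clear; nia.
rewrite el in rS *.
have [|S1 [us [st1 lk1]]] := switch_layer eS (conj Ux xS).
  by apply: roomy_le rS; rewrite leq_add2l leq_mul2l -addnA leq_addr orbT.
have sus : size us = size xs := stage_size st1.
have pus := perm_evens_odds us.
have [Ue Uo] : inputs S1 (evens us ++ odds us) /\ inputs S1 (evens us).
  have i1 : inputs S1 (evens us ++ odds us).
    by apply: inputs_perm (stage_inputs st1); rewrite perm_sym.
  split=> //; case: i1; rewrite cat_uniq => /and3P[ue _ _] i; split=> // z ze.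
  by apply: i; rewrite mem_cat ze.
have se : size (evens us) <= 2 ^ k.
  by rewrite size_evens sus; move: sxs; rewrite expnS; clear; lia.
have so : size (odds us) <= 2 ^ k.
  by rewrite size_odds sus; move: sxs; rewrite expnS; clear; lia.
have seo : size (evens us) + size (odds us) = size xs.
  by rewrite -size_cat (perm_size pus).
have [|S2 [vs0 [st2 lk2]]] := IH _ S1 se (stage_ext st1) Uo.
  apply: roomy_le rS; rewrite (stage_card st1) -/l -seo; move: (size _) (size _) L (l).
  by clear; nia.
have [|S3 [vs1 [st3 lk3]]] := IH _ S2 so (stage_ext st2) (inputs_sub Ue st2).
  apply: roomy_le rS; rewrite (stage_card st2) (stage_card st1) -/l -seo.
  by move: (size _) (size _) L (l); clear; nia.
rewrite -/l in st2 st3 lk2 lk3.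
have eoS : {subset evens us ++ odds us <= verts S1} by move=> z /Ue.2[].
have [rE23 dis23] := region_par (stage_sub st2) (stage_sub st3) Ue.1 eoS.
have st23 := stage_par st2 st3 Ue.1 eoS.
pose vs := interleave vs0 vs1.
have [ev ov] : evens vs = vs0 /\ odds vs = vs1.
  apply: interleaveK; rewrite (stage_size st2) (stage_size st3) size_evens size_odds.
  by move: (size us); clear=> n; lia.
have pvs : perm_eq (vs0 ++ vs1) vs by rewrite -ev -ov perm_evens_odds.
have st23' : stage S1 S3 us vs l by apply: stage_perm pus pvs st23.
have svs : size vs = size xs by rewrite (stage_size st23').
have [|S4 [ys [st4 lk4]]] := switch_layer (stage_ext st3) (stage_inputs st23').
  apply: roomy_le rS; rewrite (stage_card st23') (stage_card st1) sus svs.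
  by move: (size _) L (l); clear; nia.
have st34 := stage_trans st23' st4.
exists S4, ys; split.
  by rewrite -addnA; apply: stage_trans st1 st34.
move=> zs pz.
have szs : size zs = size xs by rewrite (perm_size pz) (stage_size st4).
have [bs1 [bs2 [pe po]]] := benes_split (stage_uniq st4) pz.
set zs' := swaps bs1 zs in pe po; set ys' := swaps bs2 ys in pe po.
have sys' : size ys' = size vs by rewrite size_swaps (stage_size st4).
have szs' : size zs' = size xs by rewrite size_swaps.
have [vs0' [s0 p0 z0]] : exists v', [/\ size v' = size (evens zs'), perm_eq v' vs0 &
    perm_eq (zip vs0 (evens ys')) (zip v' (evens zs'))].
  apply: perm_realign; first by rewrite -ev !size_evens sys'.
  by rewrite perm_sym.
have [vs1' [s1 p1 z1]] : exists v', [/\ size v' = size (odds zs'), perm_eq v' vs1 &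
    perm_eq (zip vs1 (odds ys')) (zip v' (odds zs'))].
  apply: perm_realign; first by rewrite -ov !size_odds sys'.
  by rewrite perm_sym.
have sue : size (evens us) = size vs0' by rewrite s0 !size_evens sus szs'.
have suo : size (odds us) = size vs1' by rewrite s1 !size_odds sus szs'.
have mid : linked S3 (region S1 S3 us) (legs l (evens us ++ odds us) (vs0' ++ vs1')).
  rewrite -(region_eq S1 S3 (perm_mem pus)) rE23 legs_cat //.
  apply: linked_cat => //; last exact: lk3.
  by apply: linked_sub (stage_sub st3) _; apply: lk2.
have last : linked S4 (region S3 S4 vs) (legs L (vs0' ++ vs1') (evens zs' ++ odds zs')).
  apply: linked_perm (lk4 bs2); apply: legs_perm; rewrite -/ys' zip_cat //.
  have := zip_split_perm (esym sys'); rewrite ev ov zip_cat; last first.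
    by rewrite -ev !size_evens sys'.
  rewrite perm_sym => /perm_trans; apply; exact: perm_cat.
have usS1 : {subset us <= verts S1} by move=> z /(stage_out st1)[].
have [r14 i14] := region_trans st23' st4 usS1.
have [r04 i04] := region_trans st1 st34 (fun z zx => (xS z zx).1).
have lk14 : linked S4 (region S1 S4 us) (legs (l + L) us zs').
  have : linked S4 (region S1 S4 us) (legs (l + L) (evens us ++ odds us) (evens zs' ++ odds zs')).
    rewrite r14; apply: linked_comp (linked_sub (stage_sub st4) mid) last.
    - by rewrite !size_cat sue suo.
    - by rewrite !size_cat s0 s1.
    - rewrite i14; apply/setP => z; rewrite !inE -(perm_mem pvs) !mem_cat.
      by rewrite (perm_mem p0) (perm_mem p1).
  apply: linked_perm; apply: legs_perm; apply: zip_split_perm.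
  by rewrite sus szs'.
rewrite r04 -addnA; apply: linked_comp (linked_sub (stage_sub st34) (lk1 bs1)) _.
- by rewrite size_swaps sus.
- by rewrite size_swaps sus.
- by rewrite i04; apply/setP => z; rewrite !inE (perm_mem (perm_swaps bs1 us)).
- apply: linked_perm lk14; apply: legs_perm; rewrite -(swapsK bs1 zs) -/zs' zip_swaps.
    by rewrite perm_sym perm_swaps.
  by rewrite sus szs'.
Qed.

Lemma bridges l xs ys S : size xs = size ys -> ext S -> inputs S (xs ++ ys) ->
  2 * h < l -> roomy S (size xs * l) ->
  exists S', [/\ ext S', subgraph S S' &
    linked S' (region S S' (xs ++ ys)) (legs l xs ys)].
Proof.
elim: xs ys S => [|x xs IH] [|y ys] // S.
  move=> _ eS _ _ _; exists S; split=> //.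
  rewrite (_ : region S S _ = set0); first exact: linked0.
  by apply/setP => z; rewrite !inE andNb.
move=> [sxy] eS [U xyS] hl rS.
have pxy : perm_eq ((x :: xs) ++ y :: ys) ([:: x; y] ++ (xs ++ ys)).
  by rewrite /= perm_cons (perm_catCA xs [:: y]).
have [Sx dx] := xyS x (mem_head _ _).
have [Sy dy] : y \in verts S /\ degree S y <= 1.
  by apply: xyS; rewrite (perm_mem pxy) !inE eqxx orbT.
have Uxy : uniq ([:: x; y] ++ (xs ++ ys)) by rewrite -(perm_uniq pxy).
have nxy : x != y by move: Uxy; rewrite /= inE negb_or => /andP[/andP[]].
have [|||q [S1 [a1 z1 p1 d1]]] := bridge jG D5 m0 h0 mh eS _ Sx Sy nxy _ _ hl.
- by apply: roomy_le rS; rewrite /= mulSn; clear; lia.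
- by move: dx D5; clear; lia.
- by move: dy D5; clear; lia.
have in1 : inputs S1 (xs ++ ys).
  move: Uxy; rewrite cat_uniq => /and3P[_ nxs Uxs]; split=> // v vx.
  have vxy : v \notin [:: x; y].
    by apply: contra nxs => vxy; apply/hasP; exists v.
  have [|Sv dv] := xyS v; first by rewrite (perm_mem pxy) mem_cat vx orbT.
  split; first exact: (subsetP (adds_sub a1).1).
  have := d1 v Sv; move: vxy; rewrite !inE negb_or => /andP[/negPf-> /negPf->].
  by rewrite !addn0 => /leq_trans; apply.
have [|S2 [eS2 sS2 lk2]] := IH ys S1 sxy (adds_ext a1) in1 hl.
  by apply: roomy_le rS; rewrite (adds_card a1) -z1 /=; clear; lia.
exists S2; split=> //; first exact: subgraph_trans (adds_sub a1) sS2.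
have S12 := subsetP (adds_sub a1).1; have S23 := subsetP sS2.1.
have qS v : v \in q -> v \notin verts S by apply: adds_new a1 _.
have Uq : uniq (x :: rcons q y).
  rewrite /= mem_rcons inE (negPf nxy) rcons_uniq (adds_uniq a1) andbT /=.
  by apply/andP; split; apply/negP => /qS; rewrite ?Sx ?Sy.
have rsub v : v \in region S1 S2 (xs ++ ys) -> v \notin q /\ v \notin [:: x; y].
  rewrite !in_setU in_setD in_set => /orP[/andP[vS1 _]|vxy].
    split; first by apply: contra vS1; rewrite (adds_verts a1) !inE => ->; rewrite orbT.
    by apply: contra vS1; rewrite !inE => /orP[]/eqP->; apply: S12.
  have [|Sv _] := xyS v; first by rewrite (perm_mem pxy) mem_cat vxy orbT.
  split; first by apply: contraL Sv => /qS.
  move: Uxy; rewrite cat_uniq => /and3P[_ /hasPn H _]; exact: H.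
have eR : region S S2 ((x :: xs) ++ y :: ys) =
    region S1 S2 (xs ++ ys) :|: [set v in x :: rcons q y].
  rewrite (region_eq S S2 (perm_mem pxy)); apply/setP => v.
  rewrite /region !in_setU !in_setD !in_set mem_cat (adds_verts a1) !inE mem_rcons inE.
  have [Sv|Sv] := boolP (v \in verts S).
    by rewrite (S23 _ (S12 _ Sv)) (contraTF (@qS v) Sv) //= !orbF orbC.
  have [vq|vq] := boolP (v \in q); last first.
    by case: (v \in verts S2); case: (v == x); case: (v == y); case: (v \in xs ++ ys).
  by rewrite S23 ?orbT // (adds_verts a1) !inE vq orbT.
rewrite eR /legs /= -[in (x, y, l)](last_rcons x q y) -{1}z1 -(size_rcons q y).
apply: linked_add => //.
- by apply: sub_path p1 => i j; apply: sS2.2.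
- move=> v; rewrite inE mem_rcons inE => vq; apply/negP => /rsub[].
  by rewrite !inE negb_or => /negPf vq' /andP[/negPf vx /negPf vy]; rewrite vx vy vq' in vq.
Qed.

End Network.

(** * The reservoir and its factors *)

Section Reservoir.
Variable T : finType.
Implicit Types (G S : graph T) (V : {set T}).

(** The network is grown from [V1] and ends in outputs [ys] of its own, which are
    then joined to [V2] in some fixed order.  To send [V1] to a permutation [zs]
    of [V2], it suffices to send [V1] to the same permutation of [ys]. *)
Lemma reservoir G D m h t l V1 V2 :
  joined m G -> 5 <= D -> 0 < m -> 0 < h -> m <= 2 ^ h ->
  [disjoint V1 & V2] -> #|V1| = #|V2| -> #|V1| <= 2 ^ t ->
  2 * t * switch_length h + 2 * h < l ->
  nat_extendable G D m (edgeless (V1 :|: V2)) ->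
  roomy G D m h (edgeless (V1 :|: V2)) (#|V1| * l) ->
  exists S, nat_extendable G D m S /\ forall zs, perm_eq zs (enum V2) ->
    linked S (verts S) (legs l (enum V1) zs).
Proof.
move=> jG D5 m0 h0 mh dV cV Nt hl eS rS; set S0 := edgeless _ in eS rS.
have d0 v : degree S0 v = 0.
  by apply/eqP; rewrite cards_eq0; apply/eqP/setP => u; rewrite !inE.
have V0 v : (v \in verts S0) = (v \in V1) || (v \in V2) by rewrite in_setU.
clearbody S0.
have V1S0 v : v \in enum V1 -> v \in verts S0 by rewrite mem_enum V0 => ->.
have V2S0 v : v \in enum V2 -> v \in verts S0 by rewrite mem_enum V0 => ->; rewrite orbT.
have V12 v : v \in enum V2 -> v \notin enum V1.
  rewrite !mem_enum => v2; apply: contraL dV => v1; apply/pred0Pn.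
  by exists v; rewrite /= v1.
have [sz1 sz2] : size (enum V1) = #|V1| /\ size (enum V2) = #|V1| by rewrite -!cardE.
pose a := 2 * t * switch_length h; pose b := l - a.
have lab : l = a + b by rewrite /b; move: hl; rewrite -/a; clear; lia.
have hb : 2 * h < b by rewrite /b; move: hl; rewrite -/a; clear; lia.
have in0 : inputs S0 (enum V1).
  by split=> [|v /V1S0]; [apply: enum_uniq | rewrite d0].
have [||S1 [ys [st1 lk1]]] := benes_network jG D5 m0 h0 mh (k := t) _ eS in0.
- by rewrite sz1.
- apply: roomy_le rS; rewrite sz1 leq_add2l leq_mul2l; apply/orP; right.
  by rewrite lab leq_addr.
have ysV z : z \in ys -> z \notin enum V2.
  by move=> /(stage_new st1)[|zS]; [apply: contraL; apply: V12 | apply: contra zS; apply: V2S0].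
have S01 := subsetP (stage_sub st1).1.
have in1 : inputs S1 (ys ++ enum V2).
  split.
    rewrite cat_uniq (stage_uniq st1) enum_uniq andbT /=; apply/hasPn => z z2.
    by apply: contraL z2; apply: ysV.
  move=> v; rewrite mem_cat => /orP[|v2]; first exact: stage_out st1 _.
  split; first exact/S01/V2S0.
  by apply: leq_trans (stage_old st1 (V2S0 _ v2) (V12 _ v2)) _; rewrite d0.
have sys : size ys = #|V1| by rewrite (stage_size st1).
have [||S2 [eS2 sS2 lk2]] := bridges jG D5 m0 h0 mh _ (stage_ext st1) in1 hb.
- by rewrite sys.
- apply: roomy_le rS; rewrite (stage_card st1) sys sz1 -/a lab mulnDr.
  by rewrite addnA.
exists S2; split=> // zs pz.
have [v' [sv pv zv]] := perm_realign (etrans sys (esym sz2)) (etrans (perm_sym _ _) pz).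
have -> : verts S2 = region S0 S1 (enum V1) :|: region S1 S2 (ys ++ enum V2).
  have S12 := subsetP sS2.1; apply/setP => z; rewrite /region !in_setU !in_setD !in_set mem_cat.
  have := @V1S0 z; have := @V2S0 z; rewrite !mem_enum => v2S0 v1S0.
  have [z0|z0] := boolP (z \in verts S0).
    rewrite (S12 _ (S01 _ z0)) (S01 _ z0) /=.
    by move: z0; rewrite V0 => /orP[]->; rewrite ?orbT.
  have -> : z \in V1 = false by apply: contraNF z0.
  have -> : z \in V2 = false by apply: contraNF z0.
  have [z1|z1] := boolP (z \in verts S1); first by rewrite (S12 _ z1).
  have -> : z \in ys = false by apply: contraNF z1 => /(stage_out st1)[].
  by rewrite /= !orbF.
rewrite lab; apply: linked_comp (linked_sub sS2 (lk1 _ pv)) (linked_perm _ lk2).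
- by rewrite sz1 sv (perm_size pz).
- exact: sv.
- apply/setP => z; rewrite in_setI !in_setU !in_setD !in_set mem_cat (perm_mem pv).
  apply/andP/idP => [[z1]|zy].
    case/orP => [/andP[/negP zS1 _]|/orP[//|z2]].
      by case: zS1; case/orP: z1 => [/andP[] //|/V1S0/S01].
    by move: z1; rewrite (V2S0 _ z2) (negPf (V12 _ z2)).
  rewrite zy orbT; split=> //; have [-> _] := stage_out st1 zy; rewrite andbT.
  by case: (stage_new st1 zy) => ->; rewrite ?orbT.
- exact: legs_perm.
Qed.


Lemma flatten_uniq_mem (A : eqType) (f : A -> seq T) (ws : seq A) u v z :
  uniq (flatten [seq f w | w <- ws]) -> u \in ws -> v \in ws ->
  z \in f u -> z \in f v -> u = v.
Proof.
move=> U uws vws zu zv; apply: contraTeq U => nuv.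
have pu := perm_to_rem uws.
have vr : v \in rem u ws by move: vws; rewrite (perm_mem pu) inE eq_sym (negPf nuv).
rewrite (perm_uniq (perm_flatten (perm_map f pu))) /= cat_uniq.
apply/negP => /and3P[_ /hasPn/(_ z) H _].
by have := H _; rewrite zu => /(_ _)/negP[] //; apply/flatten_mapP; exists v.
Qed.

Definition index_walk (ws : seq (T * seq T)) l (v : T) : 'I_l.+1 -> T :=
  let w := nth (v, [::]) ws (find (fun w => w.1 == v) ws) in
  fun i => nth v (w.1 :: w.2) i.
Arguments index_walk : clear implicits.

Lemma linked_factor S V l (phi : T -> T) :
  linked S (verts S) (legs l (enum V) (map phi (enum V))) ->
  exists P : T -> 'I_l.+1 -> T, is_factor (path_graph l) S V P /\
    forall v, v \in V -> P v ord0 = v /\ P v ord_max = phi v.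
Proof.
move=> [ws [pw pa Uw eS]].
have walkP v : v \in V -> exists2 w, w \in ws &
    [/\ w.1 = v, last v w.2 = phi v, size w.2 = l, path (adj S) v w.2 &
     index_walk ws l v =1 fun i => nth v (v :: w.2) i].
  move=> vV; have vl : (v, phi v, l) \in legs l (enum V) (map phi (enum V)).
    apply/mapP; exists (v, phi v) => //; apply/(nthP (v, v)).
    exists (index v (enum V)).
      by rewrite size_zip size_map minnn index_mem mem_enum.
    by rewrite nth_zip ?size_map // (nth_map v) ?index_mem ?mem_enum // nth_index ?mem_enum.
  move: vl; rewrite -(perm_mem pw) => /mapP[w0 w0s [ev _ _]].
  have hw : has (fun w : T * seq T => w.1 == v) ws.
    by apply/hasP; exists w0 => //; rewrite ev.
  pose w := nth (v, [::]) ws (find (fun w => w.1 == v) ws).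
  have ws_w : w \in ws by rewrite mem_nth // -has_find.
  have wv : w.1 = v by apply/eqP/(nth_find (v, [::]) hw).
  have : walk_ends w \in legs l (enum V) (map phi (enum V)).
    by rewrite -(perm_mem pw) map_f.
  case/mapP => [[x y] xy [ex ey el]]; exists w => //; split=> //.
  - rewrite -[v in last v]wv ey -wv ex; move: xy; rewrite -{1}(map_id (enum V)) zip_map.
    by case/mapP => u _ [-> ->].
  - by have /allP/(_ _ ws_w) := pa; rewrite wv.
  - by move=> i; rewrite /index_walk -/w wv.
have sub v w z : w \in ws -> w.1 = v -> z \in v :: w.2 -> z \in walk_verts ws.
  by move=> ww <- zw; apply/flatten_mapP; exists w.
have Uwalk w : w \in ws -> uniq (w.1 :: w.2).
  move=> ww; have pv : perm_eq (walk_verts ws) ((w.1 :: w.2) ++ walk_verts (rem w ws)).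
    exact: perm_flatten (perm_map (fun w => w.1 :: w.2) (perm_to_rem ww)).
  by move: Uw; rewrite (perm_uniq pv) cat_uniq => /andP[].
have img v w : w.1 = v -> size w.2 = l -> index_walk ws l v =1 (fun i => nth v (v :: w.2) i) ->
    index_walk ws l v @: verts (path_graph l) =i v :: w.2.
  move=> wv sw Pv z; apply/imsetP/idP => [[i _ ->]|].
    by rewrite Pv mem_nth //= sw.
  case/(nthP v) => i; rewrite /= sw => il <-; exists (Ordinal il) => //.
  exact: in_setT.
exists (index_walk ws l); split; last first.
  move=> v /walkP[w ww [wv lw sw pww Pv]]; rewrite !Pv; split=> //=.
  by rewrite -lw (last_nth v) sw.
split.
- move=> v /walkP[w ww [wv lw sw pww Pv]]; split.
  + move=> i j _ _; rewrite !Pv => /eqP; rewrite nth_uniq ?[size _]/= ?sw //.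
      by move=> /eqP/val_inj.
    by rewrite -wv Uwalk.
  + move=> i _; rewrite Pv -eS; apply: (sub _ _ _ ww wv).
    by rewrite mem_nth //= sw.
  + have step i : i < l -> adj S (nth v (v :: w.2) i) (nth v (v :: w.2) i.+1).
      by move=> il; have /(pathP v) := pww; apply; rewrite sw.
    move=> i j; rewrite !Pv => /orP[/eqP e|/eqP e]; [rewrite -e | rewrite adj_sym -e];
      by apply: step; rewrite -ltnS e.
- move=> u v uV vV nuv; have [w ww [wu _ sw _ Pu]] := walkP _ uV.
  have [w' ww' [wv' _ sw' _ Pv]] := walkP _ vV.
  apply/pred0Pn => -[z /= /andP[]]; rewrite (img _ w) // (img _ w') // -{1}wu -{1}wv'.
  move=> z1 z2; have e := flatten_uniq_mem (f := fun w => w.1 :: w.2) Uw ww ww' z1 z2.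
  by rewrite -wu -wv' e eqxx in nuv.
- apply/setP => z; rewrite -eS; apply/bigcupP/idP => [[v /walkP[w ww [wv _ sw _ Pv]]]|].
    by rewrite (img _ w) //; apply: sub.
  case/flatten_mapP => w ww zw.
  have wV : w.1 \in V.
    have : walk_ends w \in legs l (enum V) (map phi (enum V)) by rewrite -(perm_mem pw) map_f.
    case/mapP => [[x y] xy [ex _ _]]; rewrite ex -mem_enum.
    by move: xy; rewrite -{1}(map_id (enum V)) zip_map => /mapP[u uV [-> _]].
  exists w.1 => //; have [w' ww' [wv' _ sw' _ Pv]] := walkP _ wV.
  have ew : w' = w.
    apply: (flatten_uniq_mem (f := fun w => w.1 :: w.2) (z := w.1) Uw) => //.
      by rewrite -wv' mem_head.
    exact: mem_head.
  by rewrite (img _ w') // ew.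
Qed.

End Reservoir.

(** * Numerical estimates and the theorem *)

Local Open Scope ring_scope.

Section Estimates.
Variable R : realType.

Lemma ln2_ge_half : 2^-1 <= ln (2 : R).
Proof.
have := @le_ln1Dx R (- 2^-1).
have -> : 1 + - 2^-1 = 2^-1 :> R by field.
rewrite lnV ?posrE ?ltr0n // => H.
by rewrite -lerN2; apply: H; lra.
Qed.

Lemma up_log_le_ln n : (1 < n)%N -> (up_log 2 n)%N%:R <= 4 * ln (n%:R : R).
Proof.
move=> n1; have n0 : (0 : R) < n%:R by rewrite ltr0n; lia.
have l2 := ln2_ge_half.
have lo : (up_log 2 n)%N.-1%:R * ln 2 <= ln (n%:R : R).
  rewrite mulrC mulr_natr -lnXn ?ltr0n // ler_ln ?posrE ?exprn_gt0 ?ltr0n //; last exact: ltnW.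
  by rewrite -natrX ler_nat; apply/ltnW/up_log_gtn.
have lo2 : ln 2 <= ln (n%:R : R) by rewrite ler_ln ?posrE ?ltr0n ?ler_nat //; lia.
have t0 : (0 < up_log 2 n)%N by rewrite up_log_gt0.
rewrite -(prednK t0) -natr1.
have : 0 <= (up_log 2 n)%N.-1%:R :> R by rewrite ler0n.
move: (up_log 2 n)%N.-1%:R lo lo2 l2 => x; move: (ln _) (ln _) => b a; nra.
Qed.

(** The factor 64 is the cube of the 4 in [up_log_le_ln], and
    [4864 = 64 * (75 + 1)], the 1 making up for rounding down. *)
Lemma path_length_ge n : (1 < n)%N -> (75 * up_log 2 n ^ 3 <= path_length (4864 : R) n)%N.
Proof.
move=> n1; have lo := up_log_le_ln n1.
have t0 : (0 : R) <= (up_log 2 n)%N%:R by rewrite ler0n.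
have cube : (up_log 2 n)%N%:R ^+ 3 <= 64 * ln (n%:R : R) ^+ 3.
  have : (up_log 2 n)%N%:R ^+ 3 <= (4 * ln (n%:R : R)) ^+ 3.
    by rewrite lerXn2r ?nnegrE //; apply: le_trans lo.
  by rewrite exprMn; lra.
have l0 : 0 <= ln (n%:R : R) ^+ 3.
  have := exprn_ge0 3 t0; lra.
rewrite /path_length truncn_ge_nat; last by rewrite mulr_ge0.
rewrite natrM natrX; have := exprn_ge0 3 t0; lra.
Qed.

Lemma path_length_budget (K : R) n N : 9760 <= K -> (1 < n)%N ->
  N%:R <= n%:R / (K * ln (n%:R : R) ^+ 3) ->
  (2 * (N * (path_length (4864 : R) n + 2)) <= n)%N.
Proof.
move=> K0 n1; have l2 := ln2_ge_half.
have lo2 : ln 2 <= ln (n%:R : R).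
  by rewrite ler_ln ?posrE ?ltr0n ?ler_nat //; apply: ltnW.
set y := ln (n%:R : R) in lo2 *; have y2 : 2^-1 <= y by apply: le_trans lo2.
(* Hence [2 <= 16 * y ^+ 3], and [9760 = 2 * (4864 + 16)]. *)
have y3 : 8^-1 <= y ^+ 3.
  have -> : 8^-1 = (2^-1) ^+ 3 :> R by field.
  by rewrite lerXn2r ?nnegrE //; lra.
have lu : (path_length (4864 : R) n)%:R <= 4864 * y ^+ 3.
  by rewrite /path_length -/y truncn_le mulr_ge0 //; lra.
move: (path_length _ _) lu => l lu.
have Ky : 0 < K * y ^+ 3 by apply: mulr_gt0; [move: K0 | move: y3]; clear; lra.
rewrite -(ler_nat R) !natrM natrD ler_pdivlMr // => hN; have n0 : 0 <= N%:R :> R by rewrite ler0n.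
have : 2 * (l%:R + 2) <= K * y ^+ 3 by move: K0 y3 lu; clear; nra.
move=> /(ler_wpM2l n0) h; apply: le_trans hN; apply: le_trans h; clear; lra.
Qed.

Lemma extendable_bound n m D : (0 < D)%N ->
  (m%:R : R) <= n%:R / (100 * D%:R) -> (100 * D * m <= n)%N.
Proof.
move=> D0; rewrite ler_pdivlMr; last by rewrite -natrM ltr0n; lia.
by rewrite -!natrM ler_nat mulnC.
Qed.

End Estimates.

Theorem lemma2p3 (R : realType) :
  exists C0 K0 : R, [/\ 0 < C0, 0 < K0 &
  forall K : R, K0 <= K ->
  exists2 n0 : nat, (0 < n0)%N &
  forall n : nat, (n0 <= n)%N ->
  forall D m : nat, (100 <= D)%N -> (0 < m)%N ->
    (m%:R : R) <= n%:R / (100 * D%:R) ->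
  forall (T : finType) (G : graph T), #|verts G| = n -> joined m G ->
  forall V1 V2 : {set T},
    V1 \subset verts G -> V2 \subset verts G -> [disjoint V1 & V2] ->
    #|V1| = #|V2| ->
    (#|V1|%:R : R) <= n%:R / (K * ln (n%:R : R) ^+ 3) ->
    extendable D m G (edgeless (V1 :|: V2)) ->
  exists Sres : graph T,
    extendable D m G Sres /\
    forall phi : T -> T, bij_between V1 V2 phi ->
      exists P : T -> 'I_(path_length C0 n).+1 -> T,
        is_factor (path_graph (path_length C0 n)) Sres V1 P /\
        forall v, v \in V1 -> P v ord0 = v /\ P v ord_max = phi v].
Proof.
exists 4864, 9760; split=> [||K K0]; [lra | lra |].
exists 2%N => // n n2 D m D100 m0 mD T G nG jG V1 V2 V1G V2G dV cV hN eS.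
have D0 : (0 < D)%N by apply: leq_trans D100.
have D5 : (5 <= D)%N by apply: leq_trans D100.
have budget := path_length_budget K0 n2 hN.
have len := path_length_ge R n2.
have mn := extendable_bound D0 mD.
set l := path_length _ n in budget len *.
pose t := (up_log 2 n)%N; pose h := (up_log 2 m).+1%N.
have t0 : (0 < t)%N by rewrite up_log_gt0.
have mh : (m <= 2 ^ h)%N by rewrite expnS (leq_trans (up_logP m (isT : 1 < 2)%N)) ?leq_pmull.
have h4 : (2 ^ h <= 4 * m)%N.
  rewrite /h; have [m1|m1] := leqP m 1.
    by have -> : m = 1%N; [apply/eqP; rewrite eqn_leq m1 | rewrite up_log1].
  have := up_log_gtn (isT : 1 < 2)%N m1.
  have : (0 < up_log 2 m)%N by rewrite up_log_gt0.
  by case: (up_log 2 m)%N => // k _; rewrite /= !expnS; clear; lia.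
have mln : (m <= n)%N.
  by apply: leq_trans mn; rewrite leq_pmull // muln_gt0.
have ht : (h <= t.+1)%N by rewrite ltnS leq_up_log.
have Nt : (#|V1| <= 2 ^ t)%N.
  apply: leq_trans (up_logP n _); rewrite // -nG; exact: subset_leq_card.
(* As [h <= t + 1], the left side is less than [75 * t ^ 3]. *)
have hl : (2 * t * switch_length h + 2 * h < l)%N.
  apply: leq_trans len; rewrite -/t; move: ht t0; rewrite /switch_length; clear.
  case: t => // k; rewrite /= => hk _; have : (h * h <= k.+2 * k.+2)%N by apply: leq_mul.
  move: hk; rewrite !expnS expn0; nia.
have [||S [extS lkS]] := @reservoir T G D m h t l V1 V2 jG D5 m0 isT mh dV cV Nt hl.
- exact/extP.
(* All that is drawn takes half of [G] at most, and the slack in [roomy], being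
   of order [D * m], a small part of the other half. *)
- rewrite /roomy /room nG /= cardsU (disjoint_setI0 dV) cards0 subn0 -cV.
  have : (100 * m <= D * m)%N by rewrite leq_mul2r D100 orbT.
  by move: budget mn h4; clear; nia.
exists S; split; first exact/extP.
move=> phi [phi_inj phi_im]; apply: linked_factor; apply: lkS.
apply: uniq_perm; rewrite ?enum_uniq //.
  by rewrite map_inj_in_uniq ?enum_uniq // => x y; rewrite !mem_enum; apply: phi_inj.
move=> z; rewrite mem_enum -phi_im; apply/mapP/imsetP => -[x xV ->]; exists x => //.
  by rewrite mem_enum in xV.
by rewrite mem_enum.
Qed.
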